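(* Let $0\le q<1$ and $c>0$ be constants. Let $X$ be a random variable with $\mathbf{P}\{X=k\}=(1-q)q^{k-1}$, $k=1,2,\ldots$, and define $$c^{cr}(q)=\frac{\mathbf{E}X}{\mathbf{E}X^2}=\frac{1-q}{1+q}.$$ (i) If $c<c^{cr}(q)$, then there exists a constant $\alpha=\alpha(q,c)>\frac{1}{|\log q|}$ such that $$\mathbf{P}\{C_1(G_N(q,c))>\alpha\log N\}\to 0 \quad\text{as } N\to\infty,$$ and for any $\alpha_1<\frac{1}{|\log q|}$ $$\mathbf{P}\{C_1(G_N(q,c))<\alpha_1\log N\}\to 0\quad\text{as } N\to\infty.$$ (ii) If $c\ge c^{cr}(q)$, then $$\frac{C_1(G_N(q,c))}{N}\ \stackrel{P}{\to}\ \beta\quad\text{as } N\to\infty,$$ where $\beta=\beta(q,c)$ is the maximal solution to $$\beta=1-\frac{1}{\mathbf{E}X}\,\mathbf{E}\left\{X e^{-cX\beta}\right\}.$$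
   Context: For an integer $N>c$, $G_N(q,c)$ denotes the random graph on the vertex set $V_N=\{1,\ldots,N\}$ in which the edges between different pairs of vertices $i\neq j$ are present independently, with probability $q$ if $|i-j|=1$ and with probability $c/N$ if $|i-j|>1$. For a graph $G$, $C_1(G)$ denotes the size (number of vertices) of the largest connected component of $G$. $\stackrel{P}{\to}$ denotes convergence in probability. For $q=0$ the conventions $0^0=1$ (so $X\equiv1$) and $1/|\log q|=0$ are used. *)

(* Defs.v *)
From mathcomp Require Import all_boot all_order all_algebra.
From mathcomp Require Import all_classical all_reals all_analysis.

Set Implicit Arguments.
Unset Strict Implicit.
Unset Printing Implicit Defensive.

Import Order.TTheory GRing.Theory Num.Theory.
Import numFieldNormedType.Exports.

Local Open Scope classical_set_scope.
Local Open Scope ring_scope.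

(* The vertex set {1, ..., N} is represented by 'I_N = {0, ..., N - 1}. An
   unordered pair of distinct vertices is represented by the unique (i, j) with
   i < j, and a graph by its edge set, a subset of [vpairs N]. *)
Definition vpairs (N : nat) : {set 'I_N * 'I_N} :=
  [set e : 'I_N * 'I_N | (e.1 < e.2)%N].

Definition graph_on (N : nat) (G : {set 'I_N * 'I_N}) : bool :=
  G \subset vpairs N.

Definition adj (N : nat) (G : {set 'I_N * 'I_N}) : rel 'I_N :=
  [rel i j | ((i, j) \in G) || ((j, i) \in G)].

Definition C1 (N : nat) (G : {set 'I_N * 'I_N}) : nat :=
  (\max_(i < N) #|connect (adj G) i|)%N.

(* On [vpairs N] one has e.1 < e.2, so the truncated difference is |i - j|. *)
Definition edge_prob (R : realType) (q c : R) (N : nat) (e : 'I_N * 'I_N) : R :=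
  if (e.2 - e.1 == 1)%N then q else c / N%:R.

(* Law of G_N(q, c): product of the Bernoulli laws of the individual edges. It
   is a probability for N >= c; the finitely many smaller N are irrelevant to
   limits as N tends to infinity. *)
Definition graph_weight (R : realType) (q c : R) (N : nat)
    (G : {set 'I_N * 'I_N}) : R :=
  \prod_(e in vpairs N)
    (if e \in G then edge_prob q c e else 1 - edge_prob q c e).

Definition graph_prob (R : realType) (q c : R) (N : nat)
    (A : pred {set 'I_N * 'I_N}) : R :=
  \sum_(G : {set 'I_N * 'I_N} | graph_on G && A G) graph_weight q c G.

Definition graph_cvg_in_prob (R : realType) (q c : R)
    (Y : forall N : nat, {set 'I_N * 'I_N} -> R) (l : R) : Prop :=
  forall eps : R, 0 < eps ->
    graph_prob q c (fun G : {set 'I_N * 'I_N} => eps < `|Y N G - l|)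
      @[N --> \oo] --> (0 : R).

Definition inv_abs_log (R : realType) (q : R) : R :=
  if q == 0 then 0 else 1 / `|ln q|.

(* P{X = k} = (1 - q) q^(k-1) for k = 1, 2, ..., with 0^0 = 1. These masses sum
   to 1, so X is almost surely a positive integer. *)
Definition geometric_law (R : realType) (q : R) (d : measure_display)
    (T : measurableType d) (P : probability T R) (X : {RV P >-> R}) : Prop :=
  forall k : nat, (0 < k)%N ->
    P (X @^-1` [set k%:R]) = ((1 - q) * q ^+ k.-1)%:E.

Definition c_cr (R : realType) (d : measure_display) (T : measurableType d)
    (P : probability T R) (X : {RV P >-> R}) : R :=
  fine 'E_P[X] / fine 'E_P[(fun t => X t ^+ 2)].

(* The equation is stated in the extended reals because, for negative b, the
   expectation on the right may be infinite (b is then not a solution). *)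
Definition beta_solution (R : realType) (c : R) (d : measure_display)
    (T : measurableType d) (P : probability T R) (X : {RV P >-> R})
    (b : R) : Prop :=
  (b%:E = 1 - (1 / fine 'E_P[X])%:E *
              'E_P[(fun t => X t * expR (- (c * X t * b)))%R])%E.

Definition beta_maximal_solution (R : realType) (c : R) (d : measure_display)
    (T : measurableType d) (P : probability T R) (X : {RV P >-> R})
    (b : R) : Prop :=
  beta_solution c X b /\ forall b' : R, beta_solution c X b' -> b' <= b.

(* Main.v *)
Require Import Defs.
From mathcomp Require Import all_boot all_order all_algebra.
From mathcomp Require Import all_classical all_reals all_analysis.
From mathcomp Require Import measurable_realfun fintype finset.
From mathcomp Require Import zify ring lra.

Set Implicit Arguments.
Unset Strict Implicit.
Unset Printing Implicit Defensive.

Import Order.TTheory GRing.Theory Num.Theory.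
Import numFieldNormedType.Exports.

Local Open Scope ring_scope.

(* Explore the graph from a set S of sources, one vertex at a time, once the edges
   between consecutive vertices have been revealed; these cut the vertices into
   runs of geometric length. A run of length x is still unvisited after m steps
   with probability about (1 - c/N)^(xm), so the union of the components of S can
   have exactly m = mu N vertices only if the runs met in m steps have total length
   at most m, and about m when S is a single vertex. With high probability this
   total is about phi(mu) N, where phi(mu) = 1 - E(X e^(-cX mu)) / E X; a Chernoff
   bound, in which the expectation over the runs is controlled by a renewal
   inequality, makes any other value exponentially unlikely in m.

   A component with m vertices, where m / N exceeds the largest fixed point beta of
   phi by a constant (or where m >= alpha log N, if c < c_cr, because then
   phi(mu) <= (c / c_cr) mu), is excluded by a union bound over all vertices. For
   the lower bound let S grow by one vertex at a time: the size of the union of its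
   components goes from 0 to N while avoiding [eps N, (beta - eps) N], so it must
   jump over this interval, and a jump is at most the size of one component. *)

(** * Independent random subsets of a finite set *)

(** Every bound concerns one exact size m: fixing the number of steps in advance makes the chance
    that a run is met explicit, and the union over all sizes costs only a power of N. The runs must
    fill exactly N vertices, so their lengths are not independent. A second parameter theta with
    E(theta^X g(X)) <= 1 removes this constraint at the price theta^(-N). With z = 1/(1 - lam) and
    theta = 1/(1 + y), this condition reads lam phi(mu) <= y to first order; if phi(mu) <= k mu with
    k < k' < 1, then y = k' lam mu leaves the net exponent -(1 - k') lam m. Reversing both signs
    treats phi(mu) >= k mu with k > k' > 1. Concavity makes phi(mu)/mu monotone, so that one k,
    hence one lam, serves a whole range of sizes. The lower tail decays only in m, so it cannot
    exclude small components; this is why a growing union of components is used, whose size has to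
    cross a range of order N. *)

Section RandomSubset.
Variables (R : realType) (T : finType) (w : T -> R).
Implicit Types (E F G : {set T}) (f g : {set T} -> R).

(** The ground set [E] is a parameter, so that revealing edges in stages becomes a splitting of
    [E]. *)
Definition bern_mean E f : R :=
  \sum_(G : {set T} | G \subset E)
    (\prod_(e in E) (if e \in G then w e else 1 - w e)) * f G.

Lemma eq_bern_mean E f g : (forall G, G \subset E -> f G = g G) ->
  bern_mean E f = bern_mean E g.
Proof. by move=> fg; apply: eq_bigr => G GE; rewrite fg. Qed.

Lemma bern_mean_split E F f : [disjoint E & F] ->
  bern_mean (E :|: F) f =
  bern_mean E (fun G => bern_mean F (fun H => f (G :|: H))).
Proof.
move=> dEF; rewrite /bern_mean.
under [RHS]eq_bigr => G _ do rewrite big_distrr /=.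
rewrite pair_big_dep /=.
rewrite (reindex_onto (fun H : {set T} * {set T} => H.1 :|: H.2)
  (fun G : {set T} => (G :&: E, G :&: F))) /=; last first.
  by move=> G GEF; rewrite -setIUr; apply/setIidPl.
have disj (G H : {set T}) : G \subset E -> H \subset F ->
    (G :|: H) :&: E = G /\ (G :|: H) :&: F = H.
  move=> GE HF; rewrite !setIUl (setIidPl GE) (setIidPl HF).
  have -> : H :&: E = set0.
    apply/eqP; rewrite setI_eq0 disjoint_sym.
    exact: disjointWr dEF.
  have -> : G :&: F = set0.
    by apply/eqP; rewrite setI_eq0; apply: disjointWl dEF.
  by rewrite setU0 set0U.
apply: eq_big => [[G H]|[G H]] /=.
  apply/andP/andP => [[_ /eqP[<- <-]]|[GE HF]]; first by rewrite !subsetIr.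
  by have [-> ->] := disj _ _ GE HF; rewrite eqxx setUSS.
move=> /andP[_ /eqP[eG eH]].
have GE : G \subset E by rewrite -eG subsetIr.
have HF : H \subset F by rewrite -eH subsetIr.
rewrite mulrA; congr (_ * _).
rewrite (eq_bigl _ _ (fun e => in_setU e E F)) bigU //=.
congr (_ * _); apply: eq_bigr => e eE.
  by rewrite -{2}eG !inE eE andbT.
by rewrite -{2}eH !inE eE andbT.
Qed.

Lemma bern_mean0 f : bern_mean set0 f = f set0.
Proof.
rewrite /bern_mean (big_pred1 set0) => [|G]; last by rewrite subset0.
by rewrite big_set0 mul1r.
Qed.

Lemma bern_mean1 e f :
  bern_mean [set e] f = w e * f [set e] + (1 - w e) * f set0.
Proof.
rewrite /bern_mean (bigD1 [set e]) //= (big_pred1 set0) => [|G]; last first.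
  rewrite subset1 /=; case: (eqVneq G [set e]) => [->|_]; last by rewrite andbT.
  by rewrite -cards_eq0 cards1.
by rewrite !big_set1 !inE eqxx.
Qed.

Lemma bern_meanU1 e E f : e \notin E ->
  bern_mean (e |: E) f =
  w e * bern_mean E (fun G => f (e |: G)) + (1 - w e) * bern_mean E f.
Proof.
move=> eE; rewrite bern_mean_split ?disjoints1 // bern_mean1.
congr (_ * _ + _ * _); apply: eq_bern_mean => G _; by rewrite set0U.
Qed.

Lemma bern_mean_cst E a : bern_mean E (fun=> a) = a.
Proof.
have [n] := ubnP #|E|; elim: n E => // n IHn E.
have [->|/set0Pn[e eE]] := eqVneq E set0; first by rewrite bern_mean0.
rewrite (cardsD1 e) eE ltnS => /IHn IH.
rewrite -(setD1K eE) bern_meanU1 ?IH; first by ring.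
by rewrite !inE eqxx.
Qed.

Lemma bern_meanZ E a f : bern_mean E (fun G => a * f G) = a * bern_mean E f.
Proof.
by rewrite /bern_mean big_distrr /=; apply: eq_bigr => G _; rewrite mulrCA.
Qed.

Lemma bern_meanD E f g :
  bern_mean E (fun G => f G + g G) = bern_mean E f + bern_mean E g.
Proof.
by rewrite /bern_mean -big_split /=; apply: eq_bigr => G _; rewrite mulrDr.
Qed.

Lemma bern_mean_sum (I : Type) (r : seq I) (Q : pred I) E
    (f : I -> {set T} -> R) :
  bern_mean E (fun G => \sum_(i <- r | Q i) f i G) =
  \sum_(i <- r | Q i) bern_mean E (f i).
Proof.
rewrite /bern_mean exchange_big /=; apply: eq_bigr => G _.
by rewrite big_distrr.
Qed.

(** Marginalisation: the elements outside [F] are summed out first, with total mass one. *)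
Lemma bern_mean_res E F f : F \subset E ->
  (forall G, G \subset E -> f G = f (G :&: F)) ->
  bern_mean E f = bern_mean F f.
Proof.
move=> FE fF.
have -> : E = (E :\: F) :|: F.
  by rewrite -[in LHS](setID E F) setUC (setIidPr FE).
rewrite bern_mean_split; last first.
  by rewrite -setI_eq0 setIDAC setIC setDIl setDv set0I.
rewrite -[RHS](bern_mean_cst (E :\: F)); apply: eq_bern_mean => G GE.
apply: eq_bern_mean => H HF; rewrite fF.
  rewrite setIUl (setIidPl HF) (_ : G :&: F = set0) ?set0U //.
  apply/eqP; rewrite setI_eq0; apply: (disjointWl GE).
  by rewrite -setI_eq0 setIDAC setIC setDIl setDv set0I.
rewrite subUset (subset_trans HF FE) andbT.
exact: subset_trans GE (subsetDl _ _).
Qed.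

Lemma bern_meanM E F1 F2 f g : F1 \subset E -> F2 \subset E ->
  [disjoint F1 & F2] ->
  (forall G, G \subset E -> f G = f (G :&: F1)) ->
  (forall G, G \subset E -> g G = g (G :&: F2)) ->
  bern_mean E (fun G => f G * g G) = bern_mean E f * bern_mean E g.
Proof.
move=> F1E F2E d12 fF gF.
rewrite (@bern_mean_res E (F1 :|: F2)).
- rewrite bern_mean_split // (bern_mean_res F1E fF) (bern_mean_res F2E gF).
  rewrite mulrC -bern_meanZ; apply: eq_bern_mean => G GF.
  rewrite mulrC -bern_meanZ; apply: eq_bern_mean => H HF.
  have GHE : G :|: H \subset E.
    by rewrite subUset (subset_trans GF) // (subset_trans HF).
  rewrite fF // gF // !setIUl (setIidPl GF) (setIidPl HF).
  have -> : H :&: F1 = set0.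
    apply/eqP; rewrite setI_eq0 disjoint_sym; exact: disjointWr d12.
  have -> : G :&: F2 = set0.
    by apply/eqP; rewrite setI_eq0; apply: disjointWl d12.
  by rewrite setU0 set0U.
- by rewrite subUset F1E.
- move=> G GE; have GE' (F : {set T}) : G :&: F \subset E.
    exact: subset_trans (subsetIl _ _) GE.
  rewrite (fF _ GE) (gF _ GE) (fF (G :&: (F1 :|: F2))) //.
  rewrite (gF (G :&: (F1 :|: F2))) // -!setIA (setIidPr (subsetUl F1 F2)).
  by rewrite (setIidPr (subsetUr F1 F2)).
Qed.

Lemma bern_mean_prod (I : finType) (A : {set I}) E (F : I -> {set T})
    (f : I -> {set T} -> R) :
  (forall i, i \in A -> F i \subset E) ->
  {in A &, forall i j, i != j -> [disjoint F i & F j]} ->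
  (forall i G, i \in A -> G \subset E -> f i G = f i (G :&: F i)) ->
  bern_mean E (fun G => \prod_(i in A) f i G) = \prod_(i in A) bern_mean E (f i).
Proof.
have [n] := ubnP #|A|; elim: n A => // n IHn A.
have [-> _ _ _ _|/set0Pn[a aA]] := eqVneq A set0.
  rewrite big_set0 -[RHS](bern_mean_cst E).
  by apply: eq_bern_mean => G _; rewrite big_set0.
rewrite (cardsD1 a) aA ltnS => cA FE dF fF.
rewrite [RHS](big_setD1 a) //= -IHn //; first last.
- by move=> i G /setD1P[_ iA]; apply: fF.
- by move=> i j /setD1P[_ iA] /setD1P[_ jA]; apply: dF.
- by move=> i /setD1P[_ iA]; apply: FE.
rewrite -(@bern_meanM E (F a) (\bigcup_(i in A :\ a) F i)).
- by apply: eq_bern_mean => G _; rewrite [LHS](big_setD1 a).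
- exact: FE.
- by apply/bigcupsP => i /setD1P[_ iA]; apply: FE.
- by apply: bigcup_disjoint => i /setD1P[ia iA]; rewrite dF // eq_sym.
- by move=> G GE; apply: fF.
- move=> G GE; apply: eq_bigr => i iA'; have /setD1P[_ iA] := iA'.
  rewrite (fF _ _ iA GE) [RHS]fF //; last exact: subset_trans (subsetIl _ _) GE.
  by rewrite -setIA (setIidPr (bigcup_sup i iA')).
Qed.

Lemma bern_mean_disjoint E F : F \subset E ->
  bern_mean E (fun G => (G :&: F == set0)%:R) = \prod_(e in F) (1 - w e).
Proof.
move=> FE; rewrite (bern_mean_res FE) => [|G _]; last first.
  by rewrite -setIA setIid.
rewrite /bern_mean (bigD1 set0) ?sub0set //= set0I eqxx mulr1.
rewrite [X in _ + X]big1 => [|G].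
  by rewrite addr0; apply: eq_bigr => e eF; rewrite inE.
by move=> /andP[GF nG]; rewrite (setIidPl GF) (negPf nG) mulr0.
Qed.

Lemma bern_mean_subset E F : F \subset E ->
  bern_mean E (fun G => (F \subset G)%:R) = \prod_(e in F) w e.
Proof.
move=> FE; rewrite (bern_mean_res FE) => [|G _]; last first.
  by rewrite subsetI subxx andbT.
rewrite /bern_mean (bigD1 F) //= subxx mulr1 [X in _ + X]big1 => [|G].
  by rewrite addr0; apply: eq_bigr => e ->.
by move=> /andP[GF nG]; case: (boolP (F \subset G)) => FG;
  rewrite ?mulr0 // eqEsubset GF FG in nG *.
Qed.

Hypothesis w01 : forall e, 0 <= w e <= 1.

Lemma le_bern_mean E f g : (forall G, G \subset E -> f G <= g G) ->
  bern_mean E f <= bern_mean E g.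
Proof.
move=> fg; apply: ler_sum => G GE; apply: ler_wpM2l; last exact: fg.
by apply: prodr_ge0 => e _; have := w01 e; case: ifP => _; lra.
Qed.

Lemma bern_mean_ge0 E f : (forall G, G \subset E -> 0 <= f G) ->
  0 <= bern_mean E f.
Proof. by move=> f0; rewrite -(bern_mean_cst E 0); apply: le_bern_mean. Qed.

End RandomSubset.

Lemma eq_bern_mean_weight (R : realType) (T : finType) (w w' : T -> R)
    (E : {set T}) f : {in E, w =1 w'} -> bern_mean w E f = bern_mean w' E f.
Proof.
move=> ww'; apply: eq_bigr => G _; congr (_ * _).
by apply: eq_bigr => e eE; rewrite ww'.
Qed.

(** * Reachability *)

Section Reach.
Variable V : finType.
Implicit Types (e : rel V) (W S A B : {set V}).

(** Confining paths to [W] lets a step of the exploration delete the vertex it has processed. *)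
Definition radj e W : rel V := [rel x y | [&& e x y, x \in W & y \in W]].

Definition reach e W S : {set V} :=
  [set v | [exists s in S, connect (radj e W) s v]].

Lemma connect_closed e A x y : (forall u v, e u v -> u \in A -> v \in A) ->
  connect e x y -> x \in A -> y \in A.
Proof.
move=> clA /connectP[p + ->]; elim: p x => //= a p IHp x /andP[exa] /IHp IH xA.
by apply: IH; apply: clA exa xA.
Qed.

Lemma reachP e W S v :
  reflect (exists2 s, s \in S & connect (radj e W) s v) (v \in reach e W S).
Proof.
rewrite inE; apply: (iffP existsP) => [[s /andP[]]|[s]] *; first by exists s.
by exists s; apply/andP.
Qed.

Lemma sub_reach e W S : S \subset reach e W S.
Proof. by apply/subsetP => s sS; apply/reachP; exists s. Qed.

Lemma reach_closed e W S x y : radj e W x y ->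
  x \in reach e W S -> y \in reach e W S.
Proof.
move=> xy /reachP[s sS sx]; apply/reachP; exists s => //.
exact: connect_trans sx (connect1 xy).
Qed.

Lemma reach_min e W S A : S \subset A ->
  (forall x y, radj e W x y -> x \in A -> y \in A) -> reach e W S \subset A.
Proof.
move=> /subsetP SA clA; apply/subsetP => v /reachP[s /SA sA].
by move=> /(connect_closed clA)/(_ sA).
Qed.

Lemma reach_subset e W S : S \subset W -> reach e W S \subset W.
Proof. by move=> SW; apply: reach_min => // x y /and3P[]. Qed.

Lemma reach0 e W : reach e W set0 = set0.
Proof. by apply/eqP; rewrite -subset0 reach_min ?sub0set // => x; rewrite inE. Qed.

Lemma eq_reach e e' W S : {in W &, e =2 e'} -> reach e W S = reach e' W S.
Proof.
move=> ee'; apply/setP => v; rewrite !inE; apply: eq_existsb => s.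
congr (_ && _); apply: eq_connect => x y /=.
by apply/and3P/and3P => -[exy xW yW]; split; rewrite // -?ee' // ee'.
Qed.

(** Once every neighbour of [s] in [W] is a source, a path through [s] can be restarted at the
    vertex that follows [s], so [s] can be deleted. *)
Lemma reach_setU1 e W S B s : s \in S -> B \subset reach e W S -> s \notin B ->
  S \subset W -> {in W, forall u, e s u -> u \in S :|: B} ->
  reach e W S = s |: reach e (W :\ s) (S :\ s :|: B).
Proof.
move=> sS Brs sB SW eSB; have rW := reach_subset e SW.
apply/eqP; rewrite eqEsubset; apply/andP; split.
  apply: reach_min => [|x y /and3P[exy xW yW]].
    apply/subsetP => x xS; rewrite in_setU1; case: eqVneq => //= xs.
    by apply: (subsetP (sub_reach _ _ _)); rewrite inE in_setD1 xs xS.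
  rewrite !in_setU1; case: (eqVneq y s) => //= ys /orP[/eqP xs|xr].
    move: exy; rewrite xs => /(eSB y yW); rewrite inE => yS.
    by apply: (subsetP (sub_reach _ _ _)); rewrite inE in_setD1 ys.
  apply: (reach_closed _ (xr)); rewrite /radj /= exy !in_setD1 ys xW yW andbT /=.
  have : x \in W :\ s; last by rewrite in_setD1 => /andP[->].
  apply: (subsetP (reach_subset _ _)) xr; rewrite subUset setSD //=.
  by rewrite subsetD1 sB (subset_trans Brs rW).
rewrite subUset sub1set (subsetP (sub_reach _ _ _)) //=.
apply: reach_min => [|x y /and3P[exy /setD1P[_ xW] /setD1P[_ yW]]].
  rewrite subUset Brs andbT; apply: subset_trans (sub_reach _ _ _).
  exact: subsetDl.
by apply: reach_closed; rewrite /radj /= exy xW yW.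
Qed.

End Reach.

(** * Exploration of the long edges over fixed runs of short edges *)

Definition long_pairs (N : nat) : {set 'I_N * 'I_N} :=
  [set e in vpairs N | (e.2 - e.1 != 1)%N].

Definition edge (N : nat) (i j : 'I_N) : 'I_N * 'I_N :=
  if (i < j)%N then (i, j) else (j, i).

Definition fiber (V L : finType) (lab : V -> L) (l : L) : {set V} :=
  [set v | lab v == l].

Lemma adjU (N : nat) (G H : {set 'I_N * 'I_N}) i j :
  adj (G :|: H) i j = adj G i j || adj H i j.
Proof. by rewrite /adj /= !inE orbACA. Qed.

Lemma adjC (N : nat) (G : {set 'I_N * 'I_N}) i j : adj G i j = adj G j i.
Proof. by rewrite /adj /= orbC. Qed.

Lemma adj_edge (N : nat) (G : {set 'I_N * 'I_N}) i j : G \subset vpairs N ->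
  adj G i j = (edge i j \in G).
Proof.
move=> /subsetP Gv; rewrite /adj /edge /=; case: ltnP => ij.
  case: (boolP ((j, i) \in G)); last by rewrite orbF.
  by move=> /Gv; rewrite inE /=; lia.
case: (boolP ((i, j) \in G)); last by [].
by move=> /Gv; rewrite inE /=; lia.
Qed.

Definition long_to (N : nat) (s : 'I_N) (A : {set 'I_N}) : {set 'I_N * 'I_N} :=
  [set edge s u | u in A & edge s u \in long_pairs N].

Definition incident (N : nat) (s : 'I_N) : {set 'I_N * 'I_N} :=
  [set e | (e.1 == s) || (e.2 == s)].

Lemma edge_inj (N : nat) (s : 'I_N) : injective (edge s).
Proof.
move=> u v; rewrite /edge; case: ltnP => su; case: ltnP => sv [] //.
- by move=> svE usE; subst; lia.
- by move=> usE svE; subst; lia.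
Qed.

Lemma edge_incident (N : nat) (s u : 'I_N) : edge s u \in incident s.
Proof. by rewrite inE /edge; case: ifP; rewrite eqxx ?orbT. Qed.

Lemma long_to_incident (N : nat) (s : 'I_N) (A : {set 'I_N}) :
  long_to s A \subset incident s.
Proof. by apply/subsetP => e /imsetP[u _ ->]; apply: edge_incident. Qed.

Lemma long_to_sub (N : nat) (s : 'I_N) (A : {set 'I_N}) :
  long_to s A \subset long_pairs N.
Proof. by apply/subsetP => e /imsetP[u]; rewrite inE => /andP[_ ?] ->. Qed.

Lemma long_pairs_sub (N : nat) : long_pairs N \subset vpairs N.
Proof. by apply/subsetP => e; rewrite inE => /andP[]. Qed.

Lemma card_near (N : nat) (s : 'I_N) (A : {set 'I_N}) : s \notin A ->
  (#|[set u in A | edge s u \notin long_pairs N]| <= 2)%N.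
Proof.
move=> sA; rewrite cardE -(size_map val).
apply: (@leq_trans (size [:: s.-1; s.+1])) => //.
apply: uniq_leq_size => [|x /mapP[u]].
  by rewrite map_inj_uniq ?enum_uniq //; apply: val_inj.
rewrite mem_enum !inE => /andP[uA near] ->.
have us : (u : nat) != s by apply: contraNneq sA => /val_inj <-.
by move: near; rewrite /edge; case: (ltnP s u) => /=; lia.
Qed.

Lemma card_long_to (N : nat) (s : 'I_N) (A : {set 'I_N}) :
  (#|long_to s A| + #|[set u in A | edge s u \notin long_pairs N]| = #|A|)%N.
Proof.
rewrite card_imset; last exact: edge_inj.
rewrite -(cardsID [set u | edge s u \in long_pairs N] A); congr addn.
  by apply: eq_card => u; rewrite !inE.
by apply: eq_card => u; rewrite !inE andbC.
Qed.

(* Mean of the factor equal to [z ^+ x] if a run of length [x] is met during [j]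
   steps of the exploration, and to [1] otherwise. *)
Definition gfac (R : realType) (p z : R) (j x : nat) : R :=
  z ^+ x * (1 - ((1 - p) ^+ j) ^+ x) + ((1 - p) ^+ j) ^+ x.

Lemma gfac_gt0 (R : realType) (p z : R) (j x : nat) :
  0 <= p < 1 -> 0 < z -> 0 < gfac p z j x.
Proof.
move=> /andP[p0 p1] z0; apply: ltr_wpDl; last by rewrite !exprn_gt0 // subr_gt0.
apply: mulr_ge0; first by rewrite exprn_ge0 // ltW.
by rewrite subr_ge0 !exprn_ile1 ?exprn_ge0 //; lra.
Qed.

Section Explore.
Variables (R : realType) (p z : R) (p01 : 0 <= p < 1) (z0 : 0 < z).
Variables (N : nat) (L : finType) (lab : 'I_N -> L).
Variable G1 : {set 'I_N * 'I_N}.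
Hypothesis adj_lab : forall i j, adj G1 i j -> lab i = lab j.
Hypothesis lab_connect : forall i j, lab i = lab j -> connect (adj G1) i j.
Implicit Types (S : {set 'I_N}) (LU : {set L}) (G : {set 'I_N * 'I_N}).

Local Notation pre LU := (lab @^-1: LU).
Local Notation mean := (bern_mean (fun _ : 'I_N * 'I_N => p)).

Definition hits s LU G : {set L} :=
  [set l in LU | G :&: long_to s (fiber lab l) != set0].

Lemma lab_connect_in (W : {set 'I_N}) i j :
  fiber lab (lab i) \subset W -> lab i = lab j ->
  connect (radj (adj G1) W) i j.
Proof.
move=> /subsetP fW /lab_connect/connectP[q + ->] {j}.
suff: forall x, x \in fiber lab (lab i) -> path (adj G1) x q ->
    connect (radj (adj G1) W) x (last x q) by apply; rewrite inE.
elim: q => [|a q IHq] x xi /=; first by rewrite connect0.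
move=> /andP[xa]; have ai : a \in fiber lab (lab i).
  by move: xi; rewrite !inE (adj_lab xa).
move=> /(IHq _ ai); apply/connect_trans/connect1.
by rewrite /radj /= xa !fW.
Qed.

Lemma hitsP s LU G l : G \subset long_pairs N -> s \notin pre LU ->
  reflect (exists u, [/\ lab u = l, l \in LU & adj G s u]) (l \in hits s LU G).
Proof.
move=> GE sLU; have Gv := subset_trans GE (long_pairs_sub N).
rewrite inE; apply: (iffP andP) => [[lLU /set0Pn[e]]|[u [ul lLU su]]].
  rewrite inE => /andP[eG /imsetP[u]]; rewrite inE => /andP[+ _] eE.
  by rewrite inE => /eqP ul; exists u; split; rewrite ?adj_edge // -eE.
rewrite adj_edge // in su; split=> //; apply/set0Pn; exists (edge s u).
apply/setIP; split=> //; apply/imsetP; exists u => //.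
by have := subsetP GE _ su; rewrite !inE ul eqxx.
Qed.

(** One step of the exploration: [S] holds the active vertices and [LU] the labels of the runs not
    met so far. Runs are activated as a whole, so a short edge at [s] never leads into [pre LU];
    only long edges meet new runs. The edges at [s] are then discarded, which leaves the later steps
    independent of this one. *)
Lemma reach_explore s S LU G : G \subset long_pairs N -> s \in S ->
  [disjoint S & pre LU] ->
  let B := hits s LU G in
  let S' := (S :\ s) :|: pre B in
  let H := G :\: incident s in
  #|reach (adj (G1 :|: G)) (S :|: pre LU) S| =
  #|reach (adj (G1 :|: H)) (S' :|: pre (LU :\: B)) S'|.+1.
Proof.
move=> GE sS dS B S' H.
have sLU : s \notin pre LU by rewrite (disjointFr dS).
have BLU : B \subset LU by apply/subsetP => l; rewrite inE => /andP[].
have sB : s \notin pre B.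
  by apply: contra sLU; apply: (subsetP (preimsetS lab BLU)).
have WE : (S :|: pre LU) :\ s = S' :|: pre (LU :\: B).
  have BE : B :|: (LU :\: B) = LU.
    apply/setP => l; rewrite in_setU in_setD.
    by case: (boolP (l \in B)) => //= /(subsetP BLU).
  rewrite /S' -setUA -preimsetU BE setDUl; congr setU.
  by apply/setDidPl; rewrite disjoint_sym disjoints1.
rewrite (@reach_setU1 _ _ _ _ (pre B) s) //; first last.
- move=> u uW; rewrite adjU => /orP[/adj_lab su|su].
    rewrite inE; case/setUP: uW => [->//|]; rewrite !inE -su => ul.
    by move: sLU; rewrite inE ul.
  case/setUP: uW => [uS|]; first by rewrite inE uS.
  rewrite inE => ul; rewrite inE; apply/orP; right; rewrite inE.
  by apply/(hitsP (lab u) GE sLU); exists u.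
- exact: subsetUl.
- apply/subsetP => v; rewrite inE => /(hitsP _ GE sLU)[u [uv vLU su]].
  apply/reachP; exists s => //; apply: (@connect_trans _ _ u).
    apply: connect1; rewrite /radj /= adjU su orbT /= !inE sS uv vLU.
    by rewrite orbT.
  have : connect (radj (adj G1) (S :|: pre LU)) u v.
    apply: lab_connect_in => //; apply/subsetP => x; rewrite !inE uv.
    by move=> /eqP ->; rewrite vLU orbT.
  apply: connect_sub => x y /and3P[xy xW yW].
  by apply: connect1; rewrite /radj /= adjU xy xW yW.
rewrite WE cardsU1; have -> : s \notin
    reach (adj (G1 :|: G)) (S' :|: pre (LU :\: B)) (S :\ s :|: pre B).
  have /subsetP rW := @reach_subset _ (adj (G1 :|: G)) _ _
    (subsetUl S' (pre (LU :\: B))).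
  by apply/negP => /rW; rewrite -WE !inE eqxx.
congr (#|pred_of_set _|.+1); rewrite -/S'; apply: eq_reach => x y.
rewrite -WE => /setD1P[xs _] /setD1P[ys _]; rewrite !adjU; congr orb.
by rewrite /adj /= !inE /= !negb_or xs ys.
Qed.

Lemma long_to_disjoint s l l' : s \notin fiber lab l -> s \notin fiber lab l' ->
  l != l' ->
  [disjoint long_to s (fiber lab l) & long_to s (fiber lab l')].
Proof.
move=> sl sl' ll'; rewrite -setI_eq0; apply/eqP/setP => e; rewrite in_set0.
apply/negP => /setIP[/imsetP[u + ->] /imsetP[v + /edge_inj uv]].
rewrite !inE -uv => /andP[/eqP ul _] /andP[/eqP vl _].
by rewrite -ul vl eqxx in ll'.
Qed.

(** If [s] had a potential long edge to every vertex of each run, the recursion gfac(j + 1) = (1 -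
    p)^x gfac(j) + (1 - (1 - p)^x) z^x would give equality without the correction. The [a l]
    vertices of run [l] adjacent to [s] on the line have none, and each of them costs at most one
    factor (1 - p)^(-1). *)
Lemma mean_hits s LU (j : nat) : s \notin pre LU ->
  mean (long_pairs N) (fun G => \prod_(l in LU)
    (if l \in hits s LU G then z ^+ #|fiber lab l|
     else gfac p z j #|fiber lab l|)) <=
  (1 - p) ^- 2 * \prod_(l in LU) gfac p z j.+1 #|fiber lab l|.
Proof.
move=> sLU; have /andP[p_ge0 p_lt1] := p01.
have q0 : 0 < 1 - p by lra.
have sl l : l \in LU -> s \notin fiber lab l.
  by move=> lLU; apply: contra sLU; rewrite !inE => /eqP ->.
pose F l := long_to s (fiber lab l).
pose f l (G : {set 'I_N * 'I_N}) := z ^+ #|fiber lab l| +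
  (gfac p z j #|fiber lab l| - z ^+ #|fiber lab l|) * (G :&: F l == set0)%:R.
pose a l := #|[set u in fiber lab l | edge s u \notin long_pairs N]|.
rewrite (@eq_bern_mean _ _ _ _ _ (fun G => \prod_(l in LU) f l G)); last first.
  move=> G _; apply: eq_bigr => l lLU; rewrite inE lLU /= /f /F.
  by case: eqP => _ /=; rewrite ?mulr1 ?mulr0 ?addr0 // addrC subrK.
rewrite (@bern_mean_prod _ _ _ _ _ _ F); first last.
- by move=> l G lLU _; rewrite /f -setIA setIid.
- by move=> l l' /sl lLU /sl l'LU; apply: long_to_disjoint.
- by move=> l _; apply: long_to_sub.
have Ef l : mean (long_pairs N) (f l) =
    gfac p z j #|fiber lab l| * (1 - p) ^+ #|F l| +
    z ^+ #|fiber lab l| * (1 - (1 - p) ^+ #|F l|).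
  rewrite bern_meanD bern_mean_cst bern_meanZ bern_mean_disjoint.
    by rewrite prodr_const; ring.
  exact: long_to_sub.
apply: (@le_trans _ _ (\prod_(l in LU)
    ((1 - p) ^- a l * gfac p z j.+1 #|fiber lab l|))).
  apply: ler_prod => l lLU; rewrite Ef.
  have h1 : (1 - p) ^+ #|F l| <= 1 by rewrite exprn_ile1 //; lra.
  have h0 : 0 < (1 - p) ^+ #|F l| by rewrite exprn_gt0.
  have zx : 0 < z ^+ #|fiber lab l| by rewrite exprn_gt0.
  have g0 := @gfac_gt0 R p z j #|fiber lab l| p01 z0.
  apply/andP; split.
    by rewrite addr_ge0 // mulr_ge0 // ?subr_ge0 // ltW.
  rewrite ler_pdivlMl ?exprn_gt0 //.
  have -> : gfac p z j.+1 #|fiber lab l| =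
      gfac p z j #|fiber lab l| * (1 - p) ^+ #|fiber lab l| +
      z ^+ #|fiber lab l| * (1 - (1 - p) ^+ #|fiber lab l|).
    by rewrite /gfac exprS exprMn; ring.
  have -> : (1 - p) ^+ #|fiber lab l| = (1 - p) ^+ #|F l| * (1 - p) ^+ a l.
    by rewrite -exprD card_long_to.
  have a1 : (1 - p) ^+ a l <= 1 by rewrite exprn_ile1 //; lra.
  have a0 : 0 < (1 - p) ^+ a l by rewrite exprn_gt0.
  set zz := z ^+ _ in zx *; set h := _ ^+ #|F l| in h0 h1 *.
  set aa := _ ^+ a l in a0 a1 *; set g := gfac _ _ _ _ in g0 *.
  rewrite -subr_ge0 [X in 0 <= X](_ : _ = zz * (1 - aa)); last by ring.
  by rewrite mulr_ge0 ?subr_ge0 // ltW.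
rewrite big_split /= ler_wpM2r //.
  by apply: prodr_ge0 => l _; rewrite ltW // gfac_gt0.
under eq_bigr do rewrite -exprVn.
rewrite -expr_sum -exprVn ler_weXn2l //.
  by rewrite invf_ge1 //; lra.
have -> : (\sum_(l in LU) a l =
    #|[set u in pre LU | edge s u \notin long_pairs N]|)%N.
  rewrite -sum1dep_card (partition_big lab (mem LU)) /=; last first.
    by move=> u; rewrite !inE => /andP[].
  apply: eq_bigr => l lLU; rewrite /a -sum1dep_card; apply: eq_bigl => u.
  by rewrite !inE; case: eqP => [->|]; rewrite ?lLU ?andbT // andbF.
exact: card_near.
Qed.

(* The explored vertex has at most two short neighbours, to which no long edge can
   lead; each step pays the factor [(1 - p) ^- 2] for ignoring this. *)
Lemma explore_bound (j : nat) (S : {set 'I_N}) (LU : {set L}) :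
  [disjoint S & pre LU] ->
  mean (long_pairs N) (fun G =>
    (#|reach (adj (G1 :|: G)) (S :|: pre LU) S| == j)%:R) <=
  ((1 - p) ^- 2) ^+ j * (z ^+ #|S| / z ^+ j) *
  \prod_(l in LU) gfac p z j #|fiber lab l|.
Proof.
have p01' : 0 <= p <= 1 by have := p01; lra.
have zn0 n : 0 < z ^+ n by rewrite exprn_gt0.
have d0 n : 0 <= ((1 - p) ^- 2) ^+ n.
  by rewrite exprn_ge0 // invr_ge0 exprn_ge0 //; have := p01; lra.
have w01 (e : 'I_N * 'I_N) := p01'.
(* Chernoff: when exactly j vertices are reached, #|S| plus the length of the runs met equals j, so
   the indicator is z^(#|S| + length met - j) on the event. The induction carries the mean of this
   power. *)
elim: j S LU => [|j IHj] S LU dS.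
  (* No vertex is reached only if [S] is empty; the bound is then 1, because [gfac] equals 1 at
     [j = 0]. *)
  have [->|/set0Pn[s sS]] := eqVneq S set0.
    rewrite cards0 !expr0 invr1 !mul1r big1 => [|l _].
      rewrite -[leRHS](bern_mean_cst (fun=> p) (long_pairs N) 1).
      by apply: le_bern_mean => // G _; case: (_ == _).
    by rewrite /gfac expr0 expr1n subrr mulr0 add0r.
  rewrite (@eq_bern_mean _ _ _ _ _ (fun=> 0)) => [|G _].
    rewrite bern_mean_cst mulr_ge0 ?prodr_ge0 // => [|l _]; last first.
      by rewrite ltW // gfac_gt0.
    by rewrite mulr_ge0 // ltW // divr_gt0.
  suff -> : (#|reach (adj (G1 :|: G)) (S :|: pre LU) S| == 0%N) = false by [].
  apply/negbTE; rewrite cards_eq0; apply/set0Pn; exists s.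
  exact: (subsetP (sub_reach _ _ _)).
have [->|/set0Pn[s sS]] := eqVneq S set0.
  rewrite (@eq_bern_mean _ _ _ _ _ (fun=> 0)) => [|G _].
    rewrite bern_mean_cst mulr_ge0 ?prodr_ge0 // => [|l _]; last first.
      by rewrite ltW // gfac_gt0.
    by rewrite mulr_ge0 // ltW // divr_gt0.
  by rewrite reach0 cards0.
have sLU : s \notin pre LU by rewrite (disjointFr dS).
(* The edges in [E1] decide which runs are met now, those in [E2] everything that happens later. *)
pose E1 := long_pairs N :&: incident s; pose E2 := long_pairs N :\: incident s.
have LE : long_pairs N = E1 :|: E2 by rewrite setID.
have dE : [disjoint E1 & E2].
  rewrite -setI_eq0; apply/eqP/setP => e; rewrite !(in_setI, in_setD) in_set0.
  by case: (e \in incident s); rewrite ?andbF.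
pose Sn (B : {set L}) := (S :\ s) :|: pre B.
pose Wn (B : {set L}) := Sn B :|: pre (LU :\: B).
pose h (B : {set L}) G : R := (#|reach (adj (G1 :|: G)) (Wn B) (Sn B)| == j)%:R.
have WnE (B : {set L}) : B \subset LU -> Wn B = (S :|: pre LU) :\ s.
  move=> BLU; have BE : B :|: (LU :\: B) = LU.
    apply/setP => l; rewrite in_setU in_setD.
    by case: (boolP (l \in B)) => //= /(subsetP BLU).
  rewrite /Wn /Sn -setUA -preimsetU BE setDUl; congr setU; apply/esym.
  by apply/setDidPl; rewrite disjoint_sym disjoints1.
have hitsLU G : hits s LU G \subset LU.
  by apply/subsetP => l; rewrite inE => /andP[].
have hD (B : {set L}) G : B \subset LU -> G \subset long_pairs N ->
    h B G = h B (G :&: E2).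
  move=> BLU GE; rewrite /h; congr (#|pred_of_set _| == j)%:R.
  apply: eq_reach => x y.
  rewrite WnE // => /setD1P[xs _] /setD1P[ys _]; rewrite !adjU; congr orb.
  rewrite /adj /= !inE /= (negPf xs) (negPf ys) /=.
  by congr orb; apply/idP/andP => [xy|[]//]; split=> //;
    have := subsetP GE _ xy; rewrite !inE.
have step G : G \subset long_pairs N ->
    (#|reach (adj (G1 :|: G)) (S :|: pre LU) S| == j.+1)%:R =
    h (hits s LU G) G.
  move=> GE; rewrite (reach_explore GE sS dS) eqSS /= hD // /h.
  by rewrite /E2 setIDA (setIidPl GE).
have hitsI G : hits s LU G = hits s LU (G :&: E1).
  apply/setP => l; rewrite !inE -!setIA [_ :&: (incident s :&: _)]setIA.
  have := long_to_incident s (fiber lab l).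
  have := long_to_sub s (fiber lab l).
  move=> /setIidPr LL /setIidPr LI.
  by rewrite -setIA LI LL.
rewrite (eq_bern_mean _ step) {1}LE bern_mean_split //.
(* The inner mean is taken over a fresh copy of all long edges, as the induction hypothesis
   requires; [h] does not see the edges at [s]. *)
apply: (@le_trans _ _ (mean E1 (fun G =>
    mean (long_pairs N) (h (hits s LU G))))).
  apply: (le_bern_mean w01) => G GE1.
  rewrite [X in _ <= X](@bern_mean_res _ _ _ (long_pairs N) E2).
  - apply: (le_bern_mean w01) => H HE2.
    have GHE : G :|: H \subset long_pairs N by rewrite LE setUSS.
    have HI : H :&: E1 = set0.
      apply/eqP; rewrite setI_eq0 disjoint_sym; exact: disjointWr dE.
    have GI : G :&: E2 = set0 by apply/eqP; rewrite setI_eq0 (disjointWl GE1).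
    have -> : hits s LU (G :|: H) = hits s LU G.
      by rewrite hitsI setIUl HI setU0 -hitsI.
    by rewrite hD // setIUl GI set0U -hD // LE subsetU // HE2 orbT.
  - by rewrite LE subsetUr.
  - by move=> H HE; apply: hD.
apply: (@le_trans _ _ (((1 - p) ^- 2) ^+ j * (z ^+ #|S| / z ^+ j.+1) *
    mean (long_pairs N) (fun G => \prod_(l in LU)
    (if l \in hits s LU G then z ^+ #|fiber lab l|
     else gfac p z j #|fiber lab l|)))).
  rewrite -bern_meanZ [X in _ <= X](@bern_mean_res _ _ _ (long_pairs N) E1);
    [|by rewrite LE subsetUl|by move=> G _; rewrite hitsI].
  apply: (le_bern_mean w01) => G _; apply: le_trans (IHj _ _ _) _.
    rewrite -setI_eq0 setIUl setU_eq0; apply/andP; split.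
      rewrite setI_eq0; apply: disjointWl (subsetDl _ _) _.
      by apply: disjointWr dS; apply: preimsetS; apply: subsetDl.
    apply/eqP/setP => u; rewrite -preimsetI in_set0; apply/negP.
    by rewrite inE in_setI in_setD => /and3P[-> ].
  rewrite -!mulrA ler_wpM2l //.
  move: (hits s LU G) (hitsLU G) => B BLU.
  have -> : z ^+ #|Sn B| =
      z ^+ #|S|.-1 * \prod_(l in B) z ^+ #|fiber lab l|.
    rewrite -expr_sum -exprD; congr (_ ^+ _); rewrite cardsU.
    rewrite (_ : _ :&: _ = set0) ?cards0 ?subn0.
      rewrite (cardsD1 s S) sS; congr addn.
      rewrite -sum1_card (partition_big lab (mem B)) /=.
        apply: eq_bigr => l lB; rewrite -sum1_card; apply: eq_bigl => u.
        by rewrite !inE; case: eqP => [->|]; rewrite ?andbF ?andbT.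
      by move=> u; rewrite inE.
    apply/eqP; rewrite setI_eq0; apply: disjointWl (subsetDl _ _) _.
    by apply: disjointWr dS; apply: preimsetS.
  rewrite (bigID (mem B) (mem LU)) /=.
  rewrite [X in _ <= _ * (_ * (X * _))](_ : _ =
      \prod_(l in B) z ^+ #|fiber lab l|); last first.
    apply: eq_big => [l|l /andP[_ ->]//].
    by apply/andP/idP => [[]//|lB]; split=> //; apply: (subsetP BLU).
  rewrite [X in _ <= _ * (_ * (_ * X))](_ : _ =
      \prod_(l in LU :\: B) gfac p z j #|fiber lab l|); last first.
    apply: eq_big => [l|l /andP[_ /negPf ->]//].
    by rewrite in_setD andbC.
  rewrite (cardsD1 s S) sS /= add1n !exprS invfM.
  have zz : z * z^-1 = 1 by rewrite divff ?gt_eqF.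
  set X := \prod_(l in _) _; set Y := \prod_(l in _) _; set u := z ^+ _.
  rewrite [leRHS](_ : _ = (z * z^-1) * (u * (X * (z ^- j * Y)))); last by ring.
  by rewrite zz mul1r -!mulrA.
apply: le_trans (ler_wpM2l _ (mean_hits j sLU)) _.
  by rewrite mulr_ge0 // ltW // divr_gt0.
rewrite (exprSr ((1 - p) ^- 2)) le_eqVlt; apply/orP; left; apply/eqP.
by set A := _ ^+ j; set B := (1 - p) ^- 2; set C := z ^+ _ / _; ring.
Qed.

End Explore.

(** * Runs of short edges *)

Definition short_pairs (N : nat) : {set 'I_N * 'I_N} :=
  [set e in vpairs N | (e.2 - e.1 == 1)%N].

Section Runs.
Variable N : nat.
Implicit Types (G : {set 'I_N * 'I_N}).

Lemma vpairs_split : vpairs N = short_pairs N :|: long_pairs N.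
Proof. by apply/setP => e; rewrite !inE -andb_orr orbN andbT. Qed.

Lemma disjoint_short_long : [disjoint short_pairs N & long_pairs N].
Proof.
rewrite -setI_eq0; apply/eqP/setP => e; rewrite !inE.
by case: (_ == 1%N); rewrite ?andbF.
Qed.

(** For a set of short edges, this says that [k] is joined to its left neighbour. *)
Definition linked G (k : nat) : bool := [exists e in G, e.2 == k :> nat].

Fixpoint run_start G (k : nat) : nat :=
  if k is k'.+1 then (if linked G k then run_start G k' else k) else 0%N.

Lemma run_start_le G k : (run_start G k <= k)%N.
Proof. by elim: k => //= k IHk; case: ifP => // _; apply: leqW. Qed.

(** Labels are vertices, so that products can range over all of ['I_N]; a vertex that starts no run
    has an empty fiber. *)
Definition run_lab G (v : 'I_N) : 'I_N :=
  Ordinal (leq_ltn_trans (run_start_le G v) (ltn_ord v)).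

Lemma linkedS G (i j : 'I_N) : G \subset short_pairs N -> (i, j) \in G ->
  j = i.+1 :> nat /\ linked G j.
Proof.
move=> /subsetP Gs ijG; have := Gs _ ijG; rewrite !inE /=.
move=> /andP[ij /eqP ij1]; split; first by lia.
by apply/existsP; exists (i, j); rewrite ijG /=.
Qed.

Lemma adj_run_lab G i j : G \subset short_pairs N -> adj G i j ->
  run_lab G i = run_lab G j.
Proof.
move=> Gs /orP[/(linkedS Gs)|/(linkedS Gs)] [ij lk]; apply: val_inj => /=;
  by rewrite ij /= -ij lk.
Qed.

Lemma connect_run_lab G i : G \subset short_pairs N ->
  connect (adj G) (run_lab G i) i.
Proof.
move=> Gs; case: i => i; elim: i => [|i IHi] iN.
  by rewrite (_ : run_lab G _ = Ordinal iN) ?connect0 //; apply: val_inj.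
case: (boolP (linked G i.+1)) => lk; last first.
  rewrite (_ : run_lab G _ = Ordinal iN) ?connect0 //.
  by apply: val_inj; rewrite /= (negPf lk).
have /existsP[[a b] /andP[abG /= /eqP bi]] := lk.
have [ba _] := linkedS Gs abG.
have aE : a = Ordinal (ltnW iN) by apply: val_inj => /=; lia.
have bE : b = Ordinal iN by apply: val_inj => /=; lia.
have -> : run_lab G (Ordinal iN) = run_lab G (Ordinal (ltnW iN)).
  by apply: val_inj; rewrite /= lk.
apply: connect_trans (IHi _) (connect1 _).
by rewrite /adj /= -aE -bE abG.
Qed.

Lemma run_lab_connect G i j : G \subset short_pairs N ->
  run_lab G i = run_lab G j -> connect (adj G) i j.
Proof.
move=> Gs ij; apply: connect_trans (connect_run_lab j Gs); rewrite -ij.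
by rewrite (sym_connect_sym (adjC G)) connect_run_lab.
Qed.

(** The cutoff [k] follows the lengths of the runs while the edges are revealed from left to
    right. *)
Definition run_count G (k l : nat) : nat :=
  #|[set v : 'I_N | (v < k)%N && (run_start G v == l)]|.

Lemma fiber_run_lab G (l : 'I_N) : #|fiber (run_lab G) l| = run_count G N l.
Proof. by apply: eq_card => v; rewrite !inE ltn_ord. Qed.

Lemma run_countS G k l : (k < N)%N ->
  run_count G k.+1 l = (run_count G k l + (run_start G k == l))%N.
Proof.
move=> kN; rewrite /run_count; pose b := Ordinal kN.
rewrite (cardsD1 b) inE /= ltnS leqnn /= addnC; congr addn.
apply: eq_card => v; rewrite !inE ltnS -val_eqE /=.
by case: (ltngtP v k).
Qed.

Lemma eq_run_start G H k : (forall i, (i <= k)%N -> linked G i = linked H i) ->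
  run_start G k = run_start H k.
Proof.
elim: k => //= k IHk GH; rewrite GH ?leqnn // IHk // => i ik.
by rewrite GH // leqW.
Qed.

Lemma eq_run_count G H k l :
  (forall i, (i < k)%N -> run_start G i = run_start H i) ->
  run_count G k l = run_count H k l.
Proof.
by move=> GH; apply: eq_card => v; rewrite !inE; case: ltnP => // /GH ->.
Qed.

End Runs.

Section RunMean.
Variables (R : realType) (q : R) (g : nat -> R).

(* Conditional mean of the product of [g] over the runs still open, when the
   current run has length [x] and [n] vertices remain. *)
Fixpoint run_mean (x n : nat) : R :=
  if n is n'.+1 then q * run_mean x.+1 n' + (1 - q) * g x * run_mean 1 n'
  else g x.

Lemma run_mean_unroll x n : run_mean x n =
  \sum_(i < n) q ^+ i * (1 - q) * g (x + i)%N * run_mean 1 (n - i.+1) +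
  q ^+ n * g (x + n)%N.
Proof.
elim: n x => [|n IHn] x.
  by rewrite big_ord0 add0r expr0 mul1r addn0.
rewrite [LHS]/= {}IHn big_ord_recl expr0 mul1r addn0 subn1 /= exprS addSnnS.
set A := \sum_(i < n) _; set B := \sum_(i < n) _.
have -> : B = q * A; last by ring.
rewrite big_distrr /=; apply: eq_bigr => i _.
by rewrite exprS /bump /= add1n subSS addSnnS !mulrA.
Qed.

(** Renewal argument: the hypothesis is E(theta^X g(X)) <= 1 for a geometric X, and conditioning on
    the first run reproduces the bound. The last run is cut off by the end of the line and has
    weight q^n instead of (1 - q) q^n, whence the factor (1 - q)^(-1). The exponent n + 1 counts all
    vertices, including the one already in the run. *)
Lemma run_mean_bound (theta : R) : 0 <= q < 1 -> 0 < theta ->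
  (forall x, 0 <= g x) ->
  (forall n, \sum_(i < n) (1 - q) * q ^+ i * theta ^+ i.+1 * g i.+1 <= 1) ->
  forall n, run_mean 1 n <= (1 - q)^-1 * theta ^- n.+1.
Proof.
move=> /andP[q0 q1] t0 g0 sum_le n.
have K0 : 0 < 1 - q by lra.
have [m] := ubnP n; elim: m n => // m IHm n nm.
rewrite run_mean_unroll.
have tn i : 0 < theta ^+ i by rewrite exprn_gt0.
apply: (@le_trans _ _ ((1 - q)^-1 * theta ^- n.+1 *
    \sum_(i < n.+1) (1 - q) * q ^+ i * theta ^+ i.+1 * g i.+1)); last first.
  rewrite ler_piMr // mulr_ge0 // invr_ge0 ltW //.
rewrite big_ord_recr /= mulrDr; apply: lerD.
  rewrite big_distrr /=; apply: ler_sum => i _.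
  have := IHm (n - i.+1)%N; rewrite ltn_subLR // => IH.
  apply: (@le_trans _ _ (q ^+ i * (1 - q) * g (1 + i)%N *
      ((1 - q)^-1 * theta ^- (n - i.+1).+1))).
    apply: ler_wpM2l; last by apply: IH; lia.
    by rewrite !mulr_ge0 ?exprn_ge0 // ltW.
  rewrite le_eqVlt; apply/orP; left; apply/eqP.
  have -> : theta ^- n.+1 = theta ^- (n - i.+1).+1 * theta ^- i.+1.
    by rewrite -invfM -exprD; congr (_ ^+ _)^-1; have := ltn_ord i; lia.
  have ti : theta ^- i.+1 * theta ^+ i.+1 = 1 by rewrite mulVf // gt_eqF.
  rewrite add1n; set A := theta ^- i.+1 in ti *; set B := theta ^+ i.+1 in ti *.
  set C := theta ^- _; set Q := q ^+ i; set K := (1 - q)^-1.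
  by rewrite [RHS](_ : _ = A * B * (Q * (1 - q) * g i.+1 * (K * C)));
    [rewrite ti mul1r|ring].
rewrite add1n le_eqVlt; apply/orP; left; apply/eqP.
have ti : theta ^- n.+1 * theta ^+ n.+1 = 1 by rewrite mulVf // gt_eqF.
have ki : (1 - q)^-1 * (1 - q) = 1 by rewrite mulVf // gt_eqF.
set A := theta ^- n.+1 in ti *; set B := theta ^+ n.+1 in ti *.
set Q := q ^+ n; set K := (1 - q)^-1 in ki *.
by rewrite [RHS](_ : _ = (K * (1 - q)) * (A * B) * (Q * g n.+1));
  [rewrite ti ki !mul1r|ring].
Qed.

Hypothesis g0 : g 0 = 1.
Variable N : nat.
Implicit Types (G : {set 'I_N * 'I_N}).

Local Notation mean := (bern_mean (fun _ : 'I_N * 'I_N => q)).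

Definition short_from k : {set 'I_N * 'I_N} :=
  [set e in short_pairs N | (k <= e.2)%N].

(** [G0] is what has been revealed up to vertex [k]: the closed runs give fixed factors and the open
    run gives [run_mean]. Labels that start no run contribute [g 0 = 1]. *)
Lemma mean_runs_from k n G0 : (k.+1 + n)%N = N ->
  (forall e, e \in G0 -> (e.2 <= k)%N) ->
  mean (short_from k.+1) (fun G =>
    \prod_(l < N) g (run_count (G0 :|: G) N l)) =
  (\prod_(l < N | (l : nat) != run_start G0 k) g (run_count G0 k.+1 l)) *
  run_mean (run_count G0 k.+1 (run_start G0 k)) n.
Proof.
elim: n k G0 => [|n IHn] k G0 knN G0k.
  rewrite addn0 in knN.
  have -> : short_from k.+1 = set0.
    by apply/setP => e; rewrite !inE leqNgt ltnS; case: e => a [b bN] /=; lia.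
  have sN : (run_start G0 k < N)%N.
    by apply: leq_ltn_trans (run_start_le _ _) _; lia.
  rewrite bern_mean0 setU0 knN (bigD1 (Ordinal sN)) //= mulrC; congr (_ * _).
have kN : (k < N)%N by lia.
have k1N : (k.+1 < N)%N by lia.
pose a := Ordinal kN; pose b := Ordinal k1N.
(* Reveal the edge between [k] and [k.+1]: it either extends the open run or closes it. *)
have -> : short_from k.+1 = (a, b) |: short_from k.+2.
  apply/setP => -[x y]; rewrite !inE /= xpair_eqE -!val_eqE /=; lia.
rewrite bern_meanU1; last by rewrite !inE /= ltnn !andbF.
have G0l i : (k < i)%N -> linked G0 i = false.
  move=> ki; apply/existsP => -[e /andP[/G0k ek /eqP ei]]; lia.
have abl i : linked ((a, b) |: G0) i = (i == k.+1) || linked G0 i.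
  apply/existsP/orP => [[e /andP[/setU1P[->|eG] /eqP ei]]|[/eqP ->|]].
  - by left; rewrite -ei.
  - by right; apply/existsP; exists e; rewrite eG ei eqxx.
  - by exists (a, b); rewrite setU11 /=.
  - by move=> /existsP[e /andP[eG ei]]; exists e; rewrite setU1r.
have sab i : (i <= k)%N -> run_start ((a, b) |: G0) i = run_start G0 i.
  move=> ik; apply: eq_run_start => i' ii'; rewrite abl.
  by case: eqP => //; lia.
have cab l : run_count ((a, b) |: G0) k.+1 l = run_count G0 k.+1 l.
  by apply: eq_run_count => i; apply: sab.
under eq_bern_mean => G _ do rewrite setUA [G0 :|: _]setUC.
rewrite !IHn; [|by lia| |by lia|]; first last.
- by move=> e /G0k; apply: leqW.
- by move=> e /setU1P[->//|/G0k]; apply: leqW.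
have -> : run_start ((a, b) |: G0) k.+1 = run_start G0 k.
  by rewrite /= abl eqxx /= sab.
have -> : run_start G0 k.+1 = k.+1 by rewrite /= G0l.
have s0 : run_count G0 k.+1 k.+1 = 0%N.
  apply/eqP; rewrite cards_eq0; apply/eqP/setP => v; rewrite !inE.
  by apply/negP => /andP[vk /eqP sv]; have := run_start_le G0 v; lia.
rewrite !(@run_countS _ _ k.+1) // cab s0 /= abl eqxx G0l //= sab // eqxx addn1.
rewrite eqxx add0n.
rewrite mulrDr; congr (_ + _).
  rewrite mulrCA; congr (_ * _); apply: eq_bigr => l /negPf ls.
  by rewrite (@run_countS _ _ k.+1) //= abl eqxx cab /= sab // eq_sym ls addn0.
have -> : \prod_(l < N | (l : nat) != k.+1) g (run_count G0 k.+2 l) =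
    \prod_(l < N) g (run_count G0 k.+1 l).
  rewrite [RHS](bigD1 b) //= s0 g0 mul1r; apply: eq_bigr => l /negPf lk.
  by rewrite (@run_countS _ _ k.+1) //= G0l // eq_sym lk addn0.
have sN : (run_start G0 k < N)%N.
  by apply: leq_ltn_trans (run_start_le _ _) _.
by rewrite (bigD1 (Ordinal sN)) //=; ring.
Qed.

Lemma mean_runs : (0 < N)%N ->
  mean (short_pairs N) (fun G =>
    \prod_(l < N) g #|fiber (run_lab G) l|) = run_mean 1 N.-1.
Proof.
move=> N0; have -> : short_pairs N = short_from 1.
  by apply/setP => -[x y]; rewrite !inE /=; lia.
transitivity (mean (short_from 1) (fun G =>
    \prod_(l < N) g (run_count (set0 :|: G) N l))).
  apply: eq_bern_mean => G _; apply: eq_bigr => l _.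
  by rewrite fiber_run_lab set0U.
rewrite (@mean_runs_from 0 N.-1) ?add1n ?prednK // => [|e]; last by rewrite inE.
have c1 l : run_count (set0 : {set 'I_N * 'I_N}) 1 l = (l == 0)%N.
  rewrite run_countS //= eq_sym.
  rewrite [X in (X + _)%N](_ : _ = 0%N) //.
  by apply/eqP; rewrite cards_eq0; apply/eqP/setP => v; rewrite !inE.
rewrite c1 eqxx big1 ?mul1r // => l /negPf l0.
by rewrite c1 l0.
Qed.

End RunMean.

(** * Bounds on the law of component sizes *)

Lemma reach_id (V : finType) (e : rel V) (W S S' : {set V}) :
  S \subset S' -> S' \subset reach e W S -> reach e W S = reach e W S'.
Proof.
move=> SS' S'r; apply/eqP; rewrite eqEsubset; apply/andP; split.
  apply: reach_min => [|x y]; last exact: reach_closed.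
  exact: subset_trans (sub_reach _ _ _).
by apply: reach_min => // x y; apply: reach_closed.
Qed.

Section ComponentLaw.
Variables (R : realType) (q p z theta : R) (N j : nat).
Hypotheses (q01 : 0 <= q < 1) (p01 : 0 <= p < 1) (z0 : 0 < z) (N0 : (0 < N)%N).
Hypothesis theta0 : 0 < theta.
Hypothesis sum_le : forall n,
  \sum_(i < n) (1 - q) * q ^+ i * theta ^+ i.+1 * gfac p z j i.+1 <= 1.

Local Notation weight := (fun e : 'I_N * 'I_N =>
  if (e.2 - e.1 == 1)%N then q else p).

Definition source_labels (G : {set 'I_N * 'I_N}) (S : {set 'I_N}) : {set 'I_N} :=
  run_lab G @: S.

(** The runs that contain sources are active from the start and contribute z^x instead of [gfac].
    The factor [M] pays for replacing the one by the other, after which the product is over all runs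
    and the renewal bound applies. *)
Lemma reach_law_le (M : R) (S : {set 'I_N}) : 0 <= M ->
  (forall G : {set 'I_N * 'I_N}, G \subset short_pairs N ->
     \prod_(l in source_labels G S) z ^+ #|fiber (run_lab G) l| <=
     M * \prod_(l in source_labels G S) gfac p z j #|fiber (run_lab G) l|) ->
  bern_mean weight (vpairs N) (fun G =>
    (#|reach (adj G) setT S| == j)%:R) <=
  M * ((1 - p) ^- 2) ^+ j * z ^- j * ((1 - q)^-1 * theta ^- N).
Proof.
move=> M0 HM; have q01' : 0 <= q <= 1 by move: q01; lra.
have d0 : 0 <= ((1 - p) ^- 2) ^+ j.
  by rewrite exprn_ge0 // invr_ge0 exprn_ge0 //; move: p01; lra.
have zj : 0 < z ^- j by rewrite invr_gt0 exprn_gt0.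
have w01 (e : 'I_N * 'I_N) := q01'.
rewrite vpairs_split bern_mean_split ?disjoint_short_long //.
rewrite (@eq_bern_mean_weight _ _ _ (fun=> q)); last first.
  by move=> e; rewrite inE => /andP[_ ->].
apply: (@le_trans _ _ (M * ((1 - p) ^- 2) ^+ j * z ^- j *
    bern_mean (fun=> q) (short_pairs N) (fun G =>
      \prod_(l < N) gfac p z j #|fiber (run_lab G) l|))); last first.
  apply: ler_wpM2l; first by rewrite !mulr_ge0 // ltW.
  rewrite mean_runs //; last first.
    by rewrite /gfac !expr0 subrr mulr0 add0r.
  have := @run_mean_bound R q (gfac p z j) theta q01 theta0.
  rewrite -[in theta ^- N](prednK N0); apply=> // x.
  by rewrite ltW // gfac_gt0.
rewrite -bern_meanZ; apply: (le_bern_mean w01) => G GS.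
rewrite (@eq_bern_mean_weight _ _ _ (fun=> p)); last first.
  by move=> e; rewrite inE => /andP[_ /negPf ->].
(* Enlarging the sources to full runs does not change the set they reach. *)
pose LS := source_labels G S; pose S0 := run_lab G @^-1: LS.
have S0T : S0 :|: run_lab G @^-1: (~: LS) = setT.
  by rewrite -preimsetU setUCr preimsetT.
rewrite (@eq_bern_mean _ _ _ _ _ (fun H => (#|reach (adj (G :|: H))
    (S0 :|: run_lab G @^-1: (~: LS)) S0| == j)%:R)); last first.
  move=> H _; congr (#|pred_of_set _| == j)%:R; rewrite S0T; apply: reach_id.
    by apply/subsetP => v vS; rewrite inE; apply: imset_f.
  apply/subsetP => v; rewrite inE => /imsetP[s sS vs].
  apply/reachP; exists s => //.
  have := run_lab_connect GS (esym vs); apply: connect_sub => x y xy.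
  by apply: connect1; rewrite /radj /= adjU xy !inE.
have dS : [disjoint S0 & run_lab G @^-1: (~: LS)].
  by rewrite -setI_eq0 -preimsetI setICr preimset0.
apply: le_trans (explore_bound p01 z0 _ _ j dS) _.
- by move=> i i'; apply: adj_run_lab.
- by move=> i i'; apply: run_lab_connect.
set D := _ ^+ j in d0 *; set Z := z ^- j in zj *.
set Pl := \prod_(l in _) _; set Pall := \prod_(l < N) _.
rewrite [leLHS](_ : _ = D * Z * (z ^+ #|S0| * Pl)); last by ring.
rewrite [leRHS](_ : _ = D * Z * (M * Pall)); last by ring.
apply: ler_wpM2l; first by rewrite mulr_ge0 // ltW.
have -> : z ^+ #|S0| = \prod_(l in LS) z ^+ #|fiber (run_lab G) l|.
  rewrite -expr_sum; congr (_ ^+ _).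
  rewrite -sum1_card (partition_big (run_lab G) (mem LS)) /=; last first.
    by move=> u; rewrite inE.
  apply: eq_bigr => l lB; rewrite -sum1_card; apply: eq_bigl => u.
  by rewrite [in LHS]inE [RHS]inE; case: eqP => [->|]; rewrite ?andbF ?andbT.
rewrite [Pall](bigID (mem LS)) /= mulrA.
have -> : Pl = \prod_(l | l \notin LS) gfac p z j #|fiber (run_lab G) l|.
  by apply: eq_bigl => l; rewrite in_setC.
apply: ler_wpM2r; last exact: HM.
by apply: prodr_ge0 => l _; rewrite ltW // gfac_gt0.
Qed.

Lemma gfac_ge_exprn x : z <= 1 -> z ^+ x <= gfac p z j x.
Proof.
move=> z1; rewrite /gfac; set r := ((1 - p) ^+ j) ^+ x.
have r0 : 0 <= r by rewrite !exprn_ge0 //; move: p01; lra.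
have zx : z ^+ x <= 1 by rewrite exprn_ile1 // ltW.
nra.
Qed.

Lemma reach_law_le1 (S : {set 'I_N}) : z <= 1 ->
  bern_mean weight (vpairs N) (fun G =>
    (#|reach (adj G) setT S| == j)%:R) <=
  ((1 - p) ^- 2) ^+ j * z ^- j * ((1 - q)^-1 * theta ^- N).
Proof.
move=> z1; rewrite -[X in X * z ^- j]mul1r; apply: reach_law_le => // G _.
rewrite mul1r; apply: ler_prod => l _.
by rewrite gfac_ge_exprn // andbT exprn_ge0 // ltW.
Qed.

(* The run containing the source is never hit, so it carries the factor [z ^+ x];
   dividing by the hitting probability makes it comparable to the others. *)
Lemma reach_law_ge1 (v : 'I_N) : 1 <= z -> (0 < j)%N -> 0 < p ->
  bern_mean weight (vpairs N) (fun G =>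
    (#|reach (adj G) setT [set v]| == j)%:R) <=
  p^-1 * ((1 - p) ^- 2) ^+ j * z ^- j * ((1 - q)^-1 * theta ^- N).
Proof.
move=> z1 j0 p0; apply: reach_law_le => [|G _]; first by rewrite invr_ge0 ltW.
rewrite /source_labels imset_set1 !big_set1 ler_pdivlMl //.
set x := #|_|; have x0 : (0 < x)%N.
  by apply/card_gt0P; exists v; rewrite inE.
rewrite /gfac -exprM; set r := (1 - p) ^+ _.
have r0 : 0 <= r by rewrite exprn_ge0 //; move: p01; lra.
have rp : r <= 1 - p.
  have ? := p01; rewrite -[leRHS]expr1; apply: ler_wiXn2l; [lra|lra|].
  by rewrite muln_gt0 j0.
have zx : 0 < z ^+ x by rewrite exprn_gt0.
nra.
Qed.

End ComponentLaw.

(** * Choice of the exponential tilting *)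

Section Tilting.
Variables (R : realType) (q : R) (q01 : 0 <= q < 1).

(** Generating function E(t^X) of the geometric law. *)
Definition geo (t : R) : R := (1 - q) * t / (1 - q * t).

Lemma cvg_geo (t : R) : 0 <= t -> q * t < 1 ->
  (series (geometric ((1 - q) * t) (q * t)) n @[n --> \oo] --> geo t)%classic.
Proof.
move=> t0 qt; apply: cvg_geometric_series.
by rewrite ger0_norm // mulr_ge0 //; move: q01; lra.
Qed.

(** Expanding [gfac] splits the full series E(theta^X gfac(X)) into three generating functions; its
    terms are nonnegative, so the partial sums stay below the limit. *)
Lemma sum_gfac_le (p z theta : R) (j : nat) (r := (1 - p) ^+ j) :
  0 <= p < 1 -> 0 < z -> 0 < theta -> q * (theta * z) < 1 -> q * theta < 1 ->
  geo (theta * z) + geo (theta * r) - geo (theta * z * r) <= 1 ->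
  forall n,
  \sum_(i < n) (1 - q) * q ^+ i * theta ^+ i.+1 * gfac p z j i.+1 <= 1.
Proof.
move=> p01 z0 t0 qtz qt le1 n; apply: le_trans le1.
have r0 : 0 <= r by rewrite exprn_ge0 //; move: p01; lra.
have r1 : r <= 1 by rewrite exprn_ile1 //; move: p01; lra.
have tz0 : 0 < theta * z by rewrite mulr_gt0.
have q0 : 0 <= q by move: q01; lra.
pose u (t : R) := series (geometric ((1 - q) * t) (q * t)).
pose s n := u (theta * z) n + u (theta * r) n - u (theta * z * r) n.
have cvs : (s n @[n --> \oo] -->
    geo (theta * z) + geo (theta * r) - geo (theta * z * r))%classic.
  apply: cvgB; [apply: cvgD|]; apply: cvg_geo => //.
  - exact: ltW.
  - by rewrite mulr_ge0 // ltW.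
  - by rewrite mulrA; apply: le_lt_trans qt; rewrite ler_piMr // mulr_ge0 // ltW.
  - by rewrite mulr_ge0 // ltW.
  - rewrite mulrA; apply: le_lt_trans qtz; rewrite ler_piMr //.
    by rewrite mulr_ge0 // ltW.
have sE k : s k =
    \sum_(i < k) (1 - q) * q ^+ i * theta ^+ i.+1 * gfac p z j i.+1.
  rewrite /s /u !seriesEord -big_split -sumrB /=; apply: eq_bigr => i _.
  by rewrite /geometric /gfac -/r /= !exprMn !exprS; ring.
rewrite -sE -(cvg_lim _ cvs) //.
apply: nondecreasing_cvgn_le; last exact: (cvgP _ cvs).
  apply/nondecreasing_seqP => k; rewrite !sE big_ord_recr lerDl /=.
  rewrite mulr_ge0 //; last by rewrite ltW // gfac_gt0.
  by rewrite !mulr_ge0 // ?exprn_ge0 //; [move: q01; lra|exact: ltW].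
Qed.

(* The renewal inequality for [z = (1 - lam)^-1] and [theta = (1 + y)^-1], with
   denominators cleared. *)
Definition tilt_ok (lam y r : R) : Prop :=
  [/\ q < 1 + y, q < (1 - lam) * (1 + y) &
    (1 - q) * lam * (1 + y) * (1 - r) * ((1 - lam) * (1 + y) ^+ 2 - q ^+ 2 * r)
    <= y * ((1 - lam) * (1 + y) - q) * ((1 - lam) * (1 + y) - q * r) *
       (1 + y - q * r)].

Lemma tilt_okP (lam y r : R) : lam < 1 -> 0 <= r <= 1 -> tilt_ok lam y r ->
  geo ((1 + y)^-1 * (1 - lam)^-1) + geo ((1 + y)^-1 * r) -
  geo ((1 + y)^-1 * (1 - lam)^-1 * r) <= 1.
Proof.
move=> lam1 /andP[r0 r1] [qY qLY cond]; have /andP[q0 q1] := q01.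
have qr : q * r <= q by rewrite ler_piMr.
have Y0 : 0 < 1 + y by lra.
have L0 : 0 < 1 - lam by lra.
rewrite -subr_ge0; set LHS := (X in 0 <= X).
have -> : LHS = (y * ((1 - lam) * (1 + y) - q) *
    ((1 - lam) * (1 + y) - q * r) * (1 + y - q * r) -
    (1 - q) * lam * (1 + y) * (1 - r) *
    ((1 - lam) * (1 + y) ^+ 2 - q ^+ 2 * r)) /
    ((1 + y - q) * ((1 - lam) * (1 + y) - q) *
     ((1 - lam) * (1 + y) - q * r) * (1 + y - q * r)).
  rewrite /LHS /geo; field; rewrite !gt_eqF //; lra.
apply: divr_ge0; first by rewrite subr_ge0.
by rewrite !mulr_ge0 //; lra.
Qed.

(** Since 1 - a >= 1 - q, an absolute error e(1 - q) in t is a relative error of at most e in t -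
    a. *)
Lemma near_sub (e t a : R) : 0 <= e -> 0 <= a <= q -> `|t - 1| <= e * (1 - q) ->
  (1 - e) * (1 - a) <= t - a <= (1 + e) * (1 - a).
Proof.
move=> e0 /andP[a0 aq]; rewrite ler_distl => /andP[t1 t2].
have : e * (1 - q) <= e * (1 - a) by rewrite ler_wpM2l //; lra.
by move=> ?; apply/andP; split; lra.
Qed.

(** The constant 7 makes K|lam| at most 1/7, so that the terms of (1 - lam)(1 + y)^2 - 1 add up to
    at most 4K|lam|. *)
Lemma tilt_near (e K lam y : R) : 0 < e < 1 -> 1 <= K ->
  `|lam| <= e * (1 - q) / (7 * K) -> `|y| <= K * `|lam| ->
  [/\ `|y| <= e, `|(1 + y) - 1| <= e * (1 - q),
     `|(1 - lam) * (1 + y) - 1| <= e * (1 - q) &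
     `|(1 - lam) * (1 + y) ^+ 2 - 1| <= e * (1 - q)].
Proof.
move=> /andP[e0 e1] K1 lamb yb; have /andP[q0 q1] := q01.
set l := `|lam| in lamb yb *.
have l0 : 0 <= l by rewrite normr_ge0.
have lK : 7 * (K * l) <= e * (1 - q).
  by rewrite ler_pdivlMr in lamb; [lra|lra].
have eq1 : e * (1 - q) <= e by rewrite ler_piMr //; lra.
have Kl0 : 0 <= K * l by rewrite mulr_ge0 //; lra.
have lKl : l <= K * l by rewrite ler_peMl.
have hl : - l <= lam <= l by rewrite -ler_norml.
have hy : - (K * l) <= y <= K * l by rewrite -ler_norml.
have Kl1 : K * l <= 1 / 7 by lra.
have Y2 : `|y * lam| <= K * l * (1 / 7).
  by rewrite normrM; apply: ler_pM; rewrite ?normr_ge0 // -/l; lra.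
have YY : `|y * y| <= K * l * (1 / 7).
  by rewrite normrM; apply: ler_pM; rewrite ?normr_ge0 //; lra.
have YYL : `|y * y * lam| <= K * l * (1 / 7).
  rewrite normrM; apply: le_trans (ler_pM _ _ YY (lexx _)) _ => //.
  rewrite -/l -[leRHS]mulr1; apply: ler_pM => //; last by lra.
  by rewrite mulr_ge0 //; lra.
move: Y2 YY YYL; rewrite !ler_norml => /andP[? ?] /andP[? ?] /andP[? ?].
split.
- by apply/andP; split; lra.
- by apply/andP; split; lra.
- by apply/andP; split; lra.
- have -> : (1 - lam) * (1 + y) ^+ 2 - 1 =
    2 * y + y * y - lam - 2 * (y * lam) - y * y * lam by ring.
  by apply/andP; split; lra.
Qed.

Lemma tilt_factors (e K lam y r : R) : 0 < e < 1 -> 1 <= K -> 0 <= r <= 1 ->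
  `|lam| <= e * (1 - q) / (7 * K) -> `|y| <= K * `|lam| ->
  [/\ 1 - e <= 1 + y <= 1 + e,
     (1 - e) * (1 - q) <= (1 - lam) * (1 + y) - q <= (1 + e) * (1 - q),
     (1 - e) * (1 - q * r) <= (1 - lam) * (1 + y) - q * r
       <= (1 + e) * (1 - q * r),
     (1 - e) * (1 - q * r) <= 1 + y - q * r <= (1 + e) * (1 - q * r) &
     (1 - e) * (1 - q ^+ 2 * r) <= (1 - lam) * (1 + y) ^+ 2 - q ^+ 2 * r
       <= (1 + e) * (1 - q ^+ 2 * r) /\ (1 - e) * (1 - q) <= 1 + y - q].
Proof.
move=> e01 K1 /andP[r0 r1] lamb yb; have /andP[q0 q1] := q01.
have [ye t1 t2 t3] := tilt_near e01 K1 lamb yb.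
have e0 : 0 <= e by lra.
have qr : 0 <= q * r <= q by rewrite mulr_ge0 //= ler_piMr.
have qqr : 0 <= q ^+ 2 * r <= q.
  rewrite expr2 -mulrA !mulr_ge0 //=; apply: le_trans (_ : q * q <= _).
    by rewrite ler_wpM2l //; lra.
  by rewrite ler_piMr //; lra.
have qq : 0 <= q <= q by rewrite q0 lexx.
split; [|exact: near_sub|exact: near_sub|exact: near_sub|split].
- by move: ye; rewrite ler_norml => ?; lra.
- exact: near_sub.
- by have /andP[] := near_sub e0 qq t1.
Qed.

(** Each factor in the last condition of [tilt_ok] is replaced by its value at lam = y = 0 up to a
    relative error e: two such factors on the left and three on the right, whence (1 + e)^2 and (1 -
    e)^3. *)
Lemma tilt_chain_up (k k' e lam mu a A B D Y P1 P2 P3 P4 : R) :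
  0 <= k' -> 0 <= e <= 1 -> 0 <= lam -> 0 <= mu -> 0 <= a -> 0 <= A ->
  0 <= B -> 0 <= Y <= 1 + e -> 0 <= P4 <= (1 + e) * D ->
  (1 - e) * a <= P1 -> (1 - e) * B <= P2 -> (1 - e) * B <= P3 ->
  A * D <= k * mu * B ^+ 2 -> k * (1 + e) ^+ 2 <= k' * (1 - e) ^+ 3 ->
  a * lam * Y * A * P4 <= k' * lam * mu * P1 * P2 * P3.
Proof.
move=> k0 /andP[e0 e1] l0 mu0 a0 A0 B0 /andP[Y0 Y1] /andP[P40 P41] P1a P2B P3B.
move=> AD kk.
have e1' : 0 <= 1 - e by rewrite subr_ge0.
have e2' : 0 <= 1 + e by rewrite addr_ge0.
have al0 : 0 <= a * lam by rewrite mulr_ge0.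
have C0 : 0 <= a * lam * mu * B ^+ 2 by rewrite !mulr_ge0 ?exprn_ge0.
have S1 : a * lam * Y * A * P4 <= a * lam * (1 + e) * A * ((1 + e) * D).
  apply: ler_pM => //; first by rewrite !mulr_ge0.
  by apply: ler_wpM2r => //; apply: ler_wpM2l.
have S2 : a * lam * (1 + e) ^+ 2 * (A * D) <=
    a * lam * (1 + e) ^+ 2 * (k * mu * B ^+ 2).
  by apply: ler_wpM2l => //; rewrite mulr_ge0 ?exprn_ge0.
have S3 := ler_wpM2l C0 kk.
have S4 : k' * lam * mu * ((1 - e) * a) * ((1 - e) * B) * ((1 - e) * B) <=
    k' * lam * mu * P1 * P2 * P3.
  have ? : 0 <= k' * lam * mu by rewrite !mulr_ge0.
  have ? : 0 <= (1 - e) * a by rewrite mulr_ge0.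
  have ? : 0 <= (1 - e) * B by rewrite mulr_ge0.
  by do 2![apply: ler_pM => //; try by rewrite !mulr_ge0]; apply: ler_wpM2l.
apply: (le_trans S1); apply: le_trans _ S4.
rewrite [leLHS](_ : _ = a * lam * (1 + e) ^+ 2 * (A * D)); last by ring.
apply: (le_trans S2); move: S3; congr (_ <= _); by ring.
Qed.

Lemma tilt_chain_down (k k' e lam mu a A B D Y P1 P2 P3 P4 : R) :
  0 <= k' -> 0 <= e <= 1 -> 0 <= lam -> 0 <= mu -> 0 <= a -> 0 <= A ->
  0 <= B -> 0 <= D -> 1 - e <= Y -> (1 - e) * D <= P4 ->
  0 <= P1 <= (1 + e) * a -> 0 <= P2 <= (1 + e) * B -> 0 <= P3 <= (1 + e) * B ->
  k * mu * B ^+ 2 <= A * D -> k' * (1 + e) ^+ 3 <= k * (1 - e) ^+ 2 ->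
  k' * lam * mu * P1 * P2 * P3 <= a * lam * Y * A * P4.
Proof.
move=> k0 /andP[e0 e1] l0 mu0 a0 A0 B0 D0 Y1 P41.
move=> /andP[P10 P1a] /andP[P20 P2B] /andP[P30 P3B] AD kk.
have e1' : 0 <= 1 - e by rewrite subr_ge0.
have al0 : 0 <= a * lam by rewrite mulr_ge0.
have C0 : 0 <= a * lam * mu * B ^+ 2 by rewrite !mulr_ge0 ?exprn_ge0.
have S1 : a * lam * (1 - e) * A * ((1 - e) * D) <= a * lam * Y * A * P4.
  apply: ler_pM => //; try by rewrite !mulr_ge0.
  by apply: ler_wpM2r => //; apply: ler_wpM2l.
have S2 : a * lam * (1 - e) ^+ 2 * (k * mu * B ^+ 2) <=
    a * lam * (1 - e) ^+ 2 * (A * D).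
  by apply: ler_wpM2l => //; rewrite mulr_ge0 ?exprn_ge0.
have S3 := ler_wpM2l C0 kk.
have S4 : k' * lam * mu * P1 * P2 * P3 <=
    k' * lam * mu * ((1 + e) * a) * ((1 + e) * B) * ((1 + e) * B).
  have ? : 0 <= k' * lam * mu by rewrite !mulr_ge0.
  by do 2![apply: ler_pM => //; try by rewrite !mulr_ge0]; apply: ler_wpM2l.
apply: (le_trans S4); apply: le_trans _ S1.
rewrite [leRHS](_ : _ = a * lam * (1 - e) ^+ 2 * (A * D)); last by ring.
apply: le_trans _ S2; move: S3; congr (_ <= _); by ring.
Qed.

(** To first order the last condition of [tilt_ok] is lam (1 - r)(1 - q^2 r) <= y (1 - q r)^2. The
    slack between [k] and [k'] absorbs the higher orders with a [lam] that depends on neither [mu]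
    nor [r], which is what makes the decay rate uniform. *)
Lemma tilt_up (k k' : R) : 0 < k < k' -> k' <= 1 ->
  exists2 lam, 0 < lam < 1 & forall mu r, 0 <= mu <= 1 -> 0 <= r <= 1 ->
    (1 - r) * (1 - q ^+ 2 * r) <= k * mu * (1 - q * r) ^+ 2 ->
    tilt_ok lam (k' * lam * mu) r.
Proof.
move=> /andP[k0 kk'] k'1; have /andP[q0 q1] := q01.
(* The solution of k (1 + 3e) = k' (1 - 3e), a linear form of the requirement [kee]. *)
pose e := (k' - k) / (3 * (k + k')).
have e0 : 0 < e by rewrite divr_gt0; lra.
have eE : e * (3 * (k + k')) = k' - k by rewrite /e divfK // gt_eqF; lra.
have e1 : e < 1 by rewrite /e ltr_pdivrMr; lra.
clearbody e.
have kee : k * (1 + e) ^+ 2 <= k' * (1 - e) ^+ 3.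
  have h1 : (1 + e) ^+ 2 <= 1 + 3 * e by rewrite expr2; nra.
  have h2 : 1 - 3 * e <= (1 - e) ^+ 3.
    rewrite -subr_ge0 (_ : _ - _ = e ^+ 2 * (3 - e)); last by ring.
    by rewrite mulr_ge0 // ?exprn_ge0 //; lra.
  apply: (@le_trans _ _ (k * (1 + 3 * e))); first by rewrite ler_pM2l.
  by apply: (@le_trans _ _ (k' * (1 - 3 * e))); [lra|rewrite ler_pM2l //; lra].
pose lam := e * (1 - q) / (7 * 1); have lam0 : 0 < lam.
  by rewrite divr_gt0 // mulr_gt0 //; lra.
have lam1 : lam < 1.
  rewrite /lam ltr_pdivrMr ?mulr1 //.
  have : e * (1 - q) <= e by rewrite ler_piMr //; lra.
  by lra.
have lamE : lam <= e * (1 - q) / (7 * 1) by [].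
clearbody lam.
exists lam => [|mu r /andP[mu0 mu1] r01 h]; first by rewrite lam0.
have y0 : 0 <= k' * lam * mu by rewrite !mulr_ge0 //; lra.
have [|||||fY fq f1 f2 [f3 f4]] := @tilt_factors e 1 lam (k' * lam * mu) r.
- by rewrite e0.
- by [].
- by [].
- by rewrite gtr0_norm.
- rewrite mul1r (ger0_norm y0) (gtr0_norm lam0) mulrAC.
  by apply: ler_piMl; [exact: ltW|apply: mulr_ile1; lra].
move: y0 fY fq f1 f2 f3 => y0 /andP[fY1 fY] /andP[fq _] /andP[f1 _] /andP[f2 _].
move=> /andP[f30 f3]; have /andP[r0 r1] := r01.
have a0 : 0 < (1 - e) * (1 - q) by rewrite mulr_gt0 ?subr_gt0.
have qr : q * r <= q by rewrite ler_piMr.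
have qqr : q ^+ 2 * r <= q.
  by rewrite expr2 -mulrA -[leRHS]mulr1 ler_wpM2l // (le_trans qr) // ltW.
have e1' : 0 <= 1 - e by rewrite subr_ge0 ltW.
have A0 : 0 <= 1 - r by rewrite subr_ge0.
have q1' : 0 <= 1 - q by rewrite subr_ge0 ltW.
have k0' : 0 <= k' by rewrite ltW // (lt_trans k0).
have D0 : 0 <= 1 - q ^+ 2 * r by rewrite subr_ge0 (le_trans qqr) // ltW.
have B0 : 0 <= 1 - q * r by rewrite subr_ge0 (le_trans qr) // ltW.
split.
- by rewrite (lt_le_trans q1) // lerDl.
- by rewrite -subr_gt0 (lt_le_trans a0).
- apply: (@tilt_chain_up k k' e lam mu (1 - q) (1 - r) (1 - q * r)
    (1 - q ^+ 2 * r)) => //; rewrite ?fY ?f3 ?andbT //; try exact: ltW.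
  + by rewrite (ltW e0) ltW.
  + by rewrite addr_ge0.
  + by rewrite (le_trans _ f30) // mulr_ge0.
Qed.

Lemma tilt_down (k k' : R) : 0 < k' < k ->
  exists2 lam, 0 < lam < 1 & k' * lam < 1 /\
    forall mu r, 0 <= mu <= 1 -> 0 <= r <= 1 ->
    k * mu * (1 - q * r) ^+ 2 <= (1 - r) * (1 - q ^+ 2 * r) ->
    tilt_ok (- lam) (- (k' * lam * mu)) r.
Proof.
move=> /andP[k'0 kk']; have /andP[q0 q1] := q01.
(* The solution of k' (1 + 7e) = k (1 - 2e), a linear form of the requirement [kee]. *)
pose e := (k - k') / (7 * k' + 2 * k).
have e0 : 0 < e by rewrite divr_gt0; lra.
have eE : e * (7 * k' + 2 * k) = k - k' by rewrite /e divfK // gt_eqF; lra.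
have e1 : e < 1 by rewrite /e ltr_pdivrMr; lra.
clearbody e.
have kee : k' * (1 + e) ^+ 3 <= k * (1 - e) ^+ 2.
  have h1 : (1 + e) ^+ 3 <= 1 + 7 * e.
    rewrite -subr_ge0 (_ : _ - _ = e * (1 - e) * (4 + e)); last by ring.
    by rewrite !mulr_ge0 //; lra.
  have h2 : 1 - 2 * e <= (1 - e) ^+ 2 by rewrite expr2; nra.
  apply: (@le_trans _ _ (k' * (1 + 7 * e))); first by rewrite ler_pM2l.
  by apply: (@le_trans _ _ (k * (1 - 2 * e))); [lra|rewrite ler_pM2l //; lra].
(* Here [k'] may exceed 1, so |y| is compared with K lam instead of lam. *)
pose K := 1 + k'; have K1 : 1 <= K by rewrite /K; lra.
pose lam := e * (1 - q) / (7 * K); have lam0 : 0 < lam.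
  by rewrite divr_gt0 // ?mulr_gt0 //; lra.
have lamK : lam * (7 * K) = e * (1 - q) by rewrite /lam divfK // gt_eqF; lra.
have eq1 : e * (1 - q) <= e by rewrite ler_piMr //; lra.
have lamK' : 7 * lam + 7 * (k' * lam) < 1.
  by rewrite (_ : _ + _ = lam * (7 * K)); [lra|rewrite /K; ring].
have kl0 : 0 < k' * lam by rewrite mulr_gt0.
have lam1 : lam < 1 by lra.
have lamE : lam <= e * (1 - q) / (7 * K) by [].
clearbody lam.
exists lam; first by rewrite lam0.
split=> [|mu r /andP[mu0 mu1] r01 h]; first by lra.
have y0 : 0 <= k' * lam * mu by rewrite !mulr_ge0 //; lra.
have [|||||fY fq f1 f2 [f3 f4]] := @tilt_factors e K (- lam) (- (k' * lam * mu)) r.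
- by rewrite e0.
- by [].
- by [].
- by rewrite normrN gtr0_norm.
- rewrite !normrN (ger0_norm y0) (gtr0_norm lam0) mulrAC.
  apply: ler_wpM2r; first exact: ltW.
  apply: (@le_trans _ _ k'); last by rewrite /K lerDr.
  by rewrite ler_piMr // ltW.
move: fY fq f1 f2 f3 => /andP[fY1 _] /andP[fq0 fq] /andP[f10 f1] /andP[f20 f2].
move=> /andP[f30 f3]; have /andP[r0 r1] := r01.
have a0 : 0 < (1 - e) * (1 - q) by rewrite mulr_gt0 ?subr_gt0.
have qr : q * r <= q by rewrite ler_piMr.
have qqr : q ^+ 2 * r <= q.
  by rewrite expr2 -mulrA -[leRHS]mulr1 ler_wpM2l // (le_trans qr) // ltW.
have e1' : 0 <= 1 - e by rewrite subr_ge0 ltW.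
have A0 : 0 <= 1 - r by rewrite subr_ge0.
have q1' : 0 <= 1 - q by rewrite subr_ge0 ltW.
have D0 : 0 <= 1 - q ^+ 2 * r by rewrite subr_ge0 (le_trans qqr) // ltW.
have B0 : 0 <= 1 - q * r by rewrite subr_ge0 (le_trans qr) // ltW.
have B1 : 0 <= (1 - e) * (1 - q * r) by rewrite mulr_ge0.
have a1 : (1 - e) * (1 - q) <= (1 - e) * (1 - q * r).
  by rewrite ler_wpM2l // lerB.
have P10 : 0 < (1 + lam) * (1 - k' * lam * mu) - q.
  by move: fq0; rewrite opprK; apply: lt_le_trans.
have P30 : 0 < 1 - k' * lam * mu - q * r by rewrite (lt_le_trans a0) ?(le_trans a1).
have P20 : 0 <= (1 + lam) * (1 - k' * lam * mu) - q * r.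
  by move: f10; rewrite opprK; apply: le_trans.
split.
- by rewrite -subr_gt0 (lt_le_trans a0).
- by rewrite opprK -subr_gt0.
(* With both parameters negated the two sides change sign, so the inequality is reversed. *)
- rewrite opprK mulrN !mulNr lerN2; rewrite opprK in fq f1.
  apply: (@tilt_chain_down k k' e lam mu (1 - q) (1 - r) (1 - q * r)
    (1 - q ^+ 2 * r)) => //;
    rewrite ?fq ?f1 ?f2 ?f3 ?andbT //; try exact: ltW.
  + by rewrite (ltW e0) ltW.
  + by rewrite opprK in f30.
Qed.

End Tilting.

(** * Exponential bounds on the probability of one size *)

Section ExponentialBounds.
Variables (R : realType) (q c : R) (q01 : 0 <= q < 1) (c0 : 0 < c).

Local Notation P := (graph_prob q c).

Lemma graph_probE N (A : pred {set 'I_N * 'I_N}) :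
  P A = bern_mean (fun e : 'I_N * 'I_N => if (e.2 - e.1 == 1)%N then q else c / N%:R)
    (vpairs N) (fun G => (A G)%:R).
Proof.
rewrite /graph_prob /bern_mean big_mkcondr /=; apply: eq_bigr => G _.
by case: (A G); rewrite ?mulr1 ?mulr0.
Qed.

Lemma onem_ge_expR (x : R) : 0 <= x <= 1 / 2 -> expR (- (2 * x)) <= 1 - x.
Proof.
move=> /andP[x0 x1]; rewrite expRN -[leLHS]mul1r ler_pdivrMr ?expR_gt0 //.
apply: (@le_trans _ _ ((1 - x) * (1 + 2 * x))); first by nra.
by rewrite ler_wpM2l ?expR_ge1Dx //; lra.
Qed.

Lemma edge_prob_range N : 2 * c <= N%:R -> 0 < c / N%:R <= 1 / 2.
Proof.
have c_gt0 := c0; move=> cN; have N0 : 0 < N%:R :> R by lra.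
by rewrite divr_gt0 //= ler_pdivrMr //; lra.
Qed.

(** The short neighbours ignored at each step cost a bounded factor in total: with p = c/N, (1 -
    p)^(-1) <= e^(2p) and p m <= c. *)
Lemma correction_le N m : 2 * c <= N%:R -> (m <= N)%N ->
  ((1 - c / N%:R) ^- 2) ^+ m <= expR (4 * c).
Proof.
have c_gt0 := c0; move=> cN mN; have /andP[p0 p1] := edge_prob_range cN.
set p := c / N%:R in p0 p1 *; have N0 : 0 < N%:R :> R by lra.
have pN : p * N%:R = c by rewrite /p divfK // gt_eqF.
have h : (1 - p)^-1 <= expR (2 * p).
  rewrite -[leRHS]invrK -expRN lef_pV2 ?posrE ?expR_gt0 //; last by lra.
  by apply: onem_ge_expR; lra.
rewrite -exprVn -exprM; apply: (@le_trans _ _ (expR (2 * p) ^+ (2 * m))).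
  by apply: lerXn2r => //; rewrite nnegrE ?expR_ge0 // invr_ge0; lra.
rewrite -expRM_natl ler_expR natrM -[4](_ : 2 * 2 = 4 :> R); last by ring.
have : p * m%:R <= p * N%:R by rewrite ler_wpM2l ?ler_nat // ltW.
by rewrite pN; nra.
Qed.

Lemma expr_onem_le (x : R) n : 0 <= x <= 1 -> (1 - x) ^+ n <= expR (- (n%:R * x)).
Proof.
move=> x01; rewrite -mulrN expRM_natl; apply: lerXn2r.
- by rewrite nnegrE; lra.
- by rewrite nnegrE expR_ge0.
- by have := @expR_ge1Dx _ (- x).
Qed.

Lemma expr_onep_le (x : R) n : 0 <= x -> (1 + x) ^+ n <= expR (n%:R * x).
Proof.
move=> x0; rewrite expRM_natl; apply: lerXn2r.
- by rewrite nnegrE; lra.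
- by rewrite nnegrE expR_ge0.
- exact: expR_ge1Dx.
Qed.

(** The last hypothesis says surv(r) <= k m/N with denominators cleared. With y = k' lam m/N,
    theta^(-N) = (1 + y)^N <= e^(k' lam m), while z^(-m) <= e^(-lam m). The factor N is the 1/p of
    [reach_law_ge1]. *)
Lemma component_law_up (k : R) : 0 < k < 1 ->
  exists C delta : R, [/\ 0 < C, 0 < delta &
  forall N m (v : 'I_N) (r := (1 - c / N%:R) ^+ m),
    2 * c <= N%:R -> (0 < m <= N)%N ->
    (1 - r) * (1 - q ^+ 2 * r) <= k * (m%:R / N%:R) * (1 - q * r) ^+ 2 ->
    P (fun G : {set 'I_N * 'I_N} => #|reach (adj G) setT%SET [set v]%SET| == m)
      <= C * N%:R * expR (- (delta * m%:R))].
Proof.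
have c_gt0 := c0; move=> /andP[k0 k1]; have /andP[q0 q1] := q01.
pose k' := (1 + k) / 2.
have k'E : 2 * k' = 1 + k by rewrite /k'; field.
clearbody k'.
have kk' : 0 < k < k' by rewrite k0 /=; lra.
have k'1 : k' <= 1 by lra.
have [lam /andP[lam0 lam1] tilt] := tilt_up q01 kk' k'1.
exists (c^-1 * expR (4 * c) * (1 - q)^-1), (lam * (1 - k')).
split; first by rewrite !mulr_gt0 ?invr_gt0 ?expR_gt0 //; lra.
  by rewrite mulr_gt0 //; lra.
move=> N m v r cN /andP[m0 mN] hr.
have /andP[p0 p1] := edge_prob_range cN.
have N0 : 0 < N%:R :> R by lra.
set mu := m%:R / N%:R in hr.
have mu0 : 0 < mu by rewrite divr_gt0 // ltr0n.
have mu1 : mu <= 1 by rewrite ler_pdivrMr // mul1r ler_nat.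
have muN : N%:R * mu = m%:R by rewrite /mu mulrC divfK // gt_eqF.
clearbody mu.
have r0 : 0 <= r by rewrite exprn_ge0 //; lra.
have r1 : r <= 1 by rewrite exprn_ile1 //; lra.
have r01 : 0 <= r <= 1 by rewrite r0.
have ok := tilt mu r _ r01 hr; have {}ok : tilt_ok q lam (k' * lam * mu) r.
  by apply: ok; rewrite ltW.
have [qY qLY _] := ok.
have y0 : 0 < k' * lam * mu by rewrite !mulr_gt0 //; lra.
set y := k' * lam * mu in ok qY qLY y0.
have Y0 : 0 < 1 + y by lra.
have L0 : 0 < 1 - lam by lra.
have p01 : 0 <= c / N%:R < 1 by lra.
have z0 : 0 < (1 - lam)^-1 by rewrite invr_gt0.
have t0 : 0 < (1 + y)^-1 by rewrite invr_gt0.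
have sums := @sum_gfac_le R q q01 (c / N%:R) (1 - lam)^-1 (1 + y)^-1 m p01 z0 t0
  _ _ (tilt_okP q01 lam1 r01 ok).
rewrite graph_probE.
have z1 : 1 <= (1 - lam)^-1 by rewrite invf_ge1 //; lra.
have Nn : (0 < N)%N by rewrite -(ltr0n R).
have qtz : q * ((1 + y)^-1 * (1 - lam)^-1) < 1.
  by rewrite -invfM ltr_pdivrMr ?mulr_gt0 // mul1r mulrC.
have qt : q * (1 + y)^-1 < 1 by rewrite ltr_pdivrMr ?mul1r.
have := reach_law_ge1 q01 p01 z0 Nn t0 (sums qtz qt) v z1 m0 p0.
move=> /le_trans; apply.
rewrite (exprVn (1 - lam) m) (exprVn (1 + y) N) !invrK invf_div.
have cor := correction_le cN mN.
have l1 : (1 - lam) ^+ m <= expR (- (m%:R * lam)).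
  by apply: expr_onem_le; lra.
have l2 : (1 + y) ^+ N <= expR (k' * lam * m%:R).
  apply: le_trans (expr_onep_le _ (ltW y0)) _; rewrite ler_expR /y -muN.
  by rewrite le_eqVlt; apply/orP; left; apply/eqP; ring.
have -> : expR (- (lam * (1 - k') * m%:R)) =
    expR (- (m%:R * lam)) * expR (k' * lam * m%:R).
  by rewrite -expRD; congr expR; ring.
set E1 := expR (- _) in l1 *; set E2 := expR (k' * _ * _) in l2 *.
set D := (_ ^- 2) ^+ m in cor *; set Z := (1 - lam) ^+ m in l1 *.
set T := (1 + y) ^+ N in l2 *; set E := expR (4 * c) in cor *.
have D0 : 0 <= D by rewrite exprn_ge0 // invr_ge0 exprn_ge0 //; lra.
have Z0 : 0 <= Z by rewrite exprn_ge0 // ltW.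
have T0 : 0 <= T by rewrite exprn_ge0 // ltW.
have E0 : 0 <= E by rewrite expR_ge0.
have E10 : 0 <= E1 by rewrite expR_ge0.
have c0' : 0 <= c^-1 by rewrite invr_ge0 ltW.
have N0' : 0 <= N%:R :> R by [].
have K0 : 0 <= (1 - q)^-1 by rewrite invr_ge0; lra.
rewrite [leLHS](_ : _ = c^-1 * N%:R * (1 - q)^-1 * (D * (Z * T))); last by ring.
rewrite [leRHS](_ : _ = c^-1 * N%:R * (1 - q)^-1 * (E * (E1 * E2))); last by ring.
apply: ler_wpM2l; first by rewrite !mulr_ge0.
by apply: ler_pM; rewrite ?mulr_ge0 //; apply: ler_pM.
Qed.

(** Now z < 1 < theta: theta^(-N) <= e^(-k' lam m) outweighs z^(-m) <= e^(lam m) because k' > 1. As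
    z <= 1, any set of sources is allowed and no power of N appears. *)
Lemma component_law_down (k : R) : 1 < k ->
  exists C delta : R, [/\ 0 < C, 0 < delta &
  forall N m (S : {set 'I_N}) (r := (1 - c / N%:R) ^+ m),
    2 * c <= N%:R -> (0 < m <= N)%N ->
    k * (m%:R / N%:R) * (1 - q * r) ^+ 2 <= (1 - r) * (1 - q ^+ 2 * r) ->
    P (fun G : {set 'I_N * 'I_N} => #|reach (adj G) setT%SET S| == m)
      <= C * expR (- (delta * m%:R))].
Proof.
have c_gt0 := c0; move=> k1; have /andP[q0 q1] := q01.
pose k' := (1 + k) / 2.
have k'E : 2 * k' = 1 + k by rewrite /k'; field.
clearbody k'.
have kk' : 0 < k' < k by lra.
have [lam /andP[lam0 lam1] [kl1 tilt]] := tilt_down q01 kk'.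
exists (expR (4 * c) * (1 - q)^-1), (lam * (k' - 1)).
split; first by rewrite !mulr_gt0 ?invr_gt0 ?expR_gt0 //; lra.
  by rewrite mulr_gt0 //; lra.
move=> N m S r cN /andP[m0 mN] hr.
have /andP[p0 p1] := edge_prob_range cN.
have N0 : 0 < N%:R :> R by lra.
set mu := m%:R / N%:R in hr.
have mu0 : 0 < mu by rewrite divr_gt0 // ltr0n.
have mu1 : mu <= 1 by rewrite ler_pdivrMr // mul1r ler_nat.
have muN : N%:R * mu = m%:R by rewrite /mu mulrC divfK // gt_eqF.
clearbody mu.
have r0 : 0 <= r by rewrite exprn_ge0 //; lra.
have r1 : r <= 1 by rewrite exprn_ile1 //; lra.
have r01 : 0 <= r <= 1 by rewrite r0.
have ok := tilt mu r _ r01 hr.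
have {}ok : tilt_ok q (- lam) (- (k' * lam * mu)) r by apply: ok; rewrite ltW.
have [qY qLY _] := ok.
have y0 : 0 < k' * lam * mu by rewrite !mulr_gt0 //; lra.
have y1 : k' * lam * mu <= 1.
  by apply: mulr_ile1; [rewrite mulr_ge0 //; lra|exact: ltW|exact: ltW|].
set y := k' * lam * mu in ok qY qLY y0 y1.
have Y0 : 0 < 1 + - y by lra.
have L0 : 0 < 1 - - lam by lra.
have p01 : 0 <= c / N%:R < 1 by lra.
have z0 : 0 < (1 - - lam)^-1 by rewrite invr_gt0.
have t0 : 0 < (1 + - y)^-1 by rewrite invr_gt0.
have nlam1 : - lam < 1 by lra.
have sums := @sum_gfac_le R q q01 (c / N%:R) (1 - - lam)^-1 (1 + - y)^-1 m p01
  z0 t0 _ _ (tilt_okP q01 nlam1 r01 ok).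
rewrite graph_probE.
have z1 : (1 - - lam)^-1 <= 1 by rewrite invf_le1 //; lra.
have Nn : (0 < N)%N by rewrite -(ltr0n R).
have qtz : q * ((1 + - y)^-1 * (1 - - lam)^-1) < 1.
  by rewrite -invfM ltr_pdivrMr ?mulr_gt0 // mul1r mulrC.
have qt : q * (1 + - y)^-1 < 1 by rewrite ltr_pdivrMr ?mul1r.
have := reach_law_le1 q01 p01 z0 Nn t0 (sums qtz qt) S z1.
move=> /le_trans; apply.
rewrite (exprVn (1 - - lam) m) (exprVn (1 + - y) N) !invrK opprK.
have cor := correction_le cN mN.
have l1 : (1 + lam) ^+ m <= expR (m%:R * lam).
  by apply: expr_onep_le; lra.
have l2 : (1 - y) ^+ N <= expR (- (k' * lam * m%:R)).
  apply: le_trans (@expr_onem_le y N _) _; first by lra.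
  by rewrite ler_expR /y -muN le_eqVlt; apply/orP; left; apply/eqP; ring.
have -> : expR (- (lam * (k' - 1) * m%:R)) =
    expR (m%:R * lam) * expR (- (k' * lam * m%:R)).
  by rewrite -expRD; congr expR; ring.
set E1 := expR (m%:R * _) in l1 *; set E2 := expR (- _) in l2 *.
set D := (_ ^- 2) ^+ m in cor *; set Z := (1 + lam) ^+ m in l1 *.
set T := (1 - y) ^+ N in l2 *; set E := expR (4 * c) in cor *.
have D0 : 0 <= D by rewrite exprn_ge0 // invr_ge0 exprn_ge0 //; lra.
have Z0 : 0 <= Z by rewrite exprn_ge0 //; lra.
have T0 : 0 <= T by rewrite exprn_ge0 //; lra.
have E0 : 0 <= E by rewrite expR_ge0.
have E10 : 0 <= E1 by rewrite expR_ge0.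
have K0 : 0 <= (1 - q)^-1 by rewrite invr_ge0; lra.
rewrite [leLHS](_ : _ = (1 - q)^-1 * (D * (Z * T))); last by ring.
rewrite [leRHS](_ : _ = (1 - q)^-1 * (E * (E1 * E2))); last by ring.
apply: ler_wpM2l; first by [].
by apply: ler_pM; rewrite ?mulr_ge0 //; apply: ler_pM.
Qed.

End ExponentialBounds.

(** * The survival function and its largest fixed point *)

Section SurvivalFunction.
Variables (R : realType) (q : R) (q01 : 0 <= q < 1).

(* [1 - E(X s^X) / E X] for a geometric variable [X]. *)
Definition surv (s : R) : R := 1 - (1 - q) ^+ 2 * s / (1 - q * s) ^+ 2.

Lemma surv_den_gt0 s : 0 <= s <= 1 -> 0 < 1 - q * s.
Proof.
by have /andP[q0 q1] := q01; move=> /andP[s0 s1];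
  rewrite subr_gt0 (le_lt_trans _ q1) // ler_piMr.
Qed.

Lemma survE s : 0 <= s <= 1 ->
  surv s = (1 - s) * (1 - q ^+ 2 * s) / (1 - q * s) ^+ 2.
Proof. by move=> /surv_den_gt0 d0; rewrite /surv; field; rewrite gt_eqF. Qed.

Lemma surv_le s : 0 <= s -> surv s <= 1.
Proof.
move=> s0; rewrite /surv gerBl; apply: divr_ge0.
  by rewrite mulr_ge0 // sqr_ge0.
by rewrite sqr_ge0.
Qed.

Lemma ler_surv s t : 0 <= s -> s <= t -> t <= 1 -> surv t <= surv s.
Proof.
move=> s0 st t1; have /andP[q0 q1] := q01.
have dt : 0 < 1 - q * t by apply: surv_den_gt0; lra.
have ds : 0 < 1 - q * s by apply: surv_den_gt0; lra.
rewrite /surv lerB // -!(mulrA (_ ^+ 2)); apply: ler_wpM2l; first exact: sqr_ge0.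
apply: ler_pM => //; first by rewrite invr_ge0 sqr_ge0.
rewrite lef_pV2 ?posrE ?exprn_gt0 //.
apply: lerXn2r; rewrite ?nnegrE; [exact: ltW|exact: ltW|].
by rewrite lerB // ler_wpM2l.
Qed.

Lemma expRN_01 (y : R) : 0 <= y -> 0 <= expR (- y) <= 1.
Proof. by move=> y0; rewrite expR_ge0 -expR0 ler_expR oppr_le0. Qed.

(** Strict convexity: [h1] and [h2] compare u -> e^(-u) with its tangent at t y, at the points 0 and
    y; the weights 1 - t and t cancel the linear terms. *)
Lemma expRN_scale (y t : R) : 0 < y -> 0 < t < 1 ->
  t * (1 - expR (- y)) < 1 - expR (- (t * y)).
Proof.
move=> y0 /andP[t0 t1]; set w := expR (- (t * y)).
have w0 : 0 < w by rewrite expR_gt0.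
have E1 : w * expR (t * y) = 1 by rewrite -expRD addNr expR0.
have E2 : w * expR (- ((1 - t) * y)) = expR (- y).
  by rewrite -expRD; congr expR; ring.
have h1 : w * (1 + t * y) < 1.
  by rewrite -[ltRHS]E1 ltr_pM2l // expR_gt1Dx // gt_eqF // mulr_gt0.
have h2 : w * (1 - (1 - t) * y) <= expR (- y).
  by rewrite -[leRHS]E2 ler_pM2l // expR_ge1Dx.
nra.
Qed.

(** By [survE], surv(s) is 1 - s times this ratio; its monotonicity reduces the scaling inequality
    for surv(e^(-y)) to that for 1 - e^(-y). *)
Lemma surv_ratio_mono s t : 0 <= s -> s <= t -> t <= 1 ->
  (1 - q ^+ 2 * s) / (1 - q * s) ^+ 2 <= (1 - q ^+ 2 * t) / (1 - q * t) ^+ 2.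
Proof.
move=> s0 st t1; have /andP[q0 q1] := q01.
have dt : 0 < 1 - q * t by apply: surv_den_gt0; lra.
have ds : 0 < 1 - q * s by apply: surv_den_gt0; lra.
rewrite ler_pdivrMr ?exprn_gt0 // [leRHS]mulrAC ler_pdivlMr ?exprn_gt0 //.
rewrite -subr_ge0 [X in 0 <= X](_ : _ =
  (t - s) * q * ((1 - q) ^+ 2 * (2 + q) +
    ((1 - s) + (1 - t)) * (q * (1 - q) * (1 + q)) +
    q ^+ 3 * (1 - s) * (1 - t))); last by ring.
have [? ?] : 0 <= 1 - s /\ 0 <= 1 - t by lra.
have [? [? ?]] : 0 <= 1 - q /\ 0 <= 1 + q /\ 0 <= 2 + q by lra.
have ? : 0 <= t - s by rewrite subr_ge0.
have ? : 0 <= (1 - s) + (1 - t) by apply: addr_ge0.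
apply: mulr_ge0; first by rewrite mulr_ge0.
by apply: addr_ge0; [apply: addr_ge0|]; rewrite !mulr_ge0 ?exprn_ge0.
Qed.

Lemma surv_gt0 s : 0 <= s < 1 -> 0 < surv s.
Proof.
move=> /andP[s0 s1]; have /andP[q0 q1] := q01; rewrite survE; last by lra.
have d0 : 0 < 1 - q * s by apply: surv_den_gt0; lra.
apply: divr_gt0; last exact: exprn_gt0.
rewrite mulr_gt0 ?subr_gt0 //.
by apply: (le_lt_trans _ s1); rewrite ler_piMl // exprn_ile1 // ltW.
Qed.

(* Strict concavity of [y |-> surv (exp (- y))] at the origin, where it vanishes. *)
Lemma surv_scale (y t : R) : 0 < y -> 0 < t < 1 ->
  t * surv (expR (- y)) < surv (expR (- (t * y))).
Proof.
move=> y0 t01; have /andP[t0 t1] := t01.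
have ty : 0 < t * y by rewrite mulr_gt0.
have s01 := expRN_01 (ltW y0); have w01 := expRN_01 (ltW ty).
have sw : expR (- y) <= expR (- (t * y)).
  by rewrite ler_expR lerN2 ger_pMl // ltW.
have /andP[s0 s1] := s01; have /andP[w0 w1] := w01.
rewrite !survE // -!(mulrA (1 - _)) (mulrA t).
have := surv_ratio_mono s0 sw w1.
set hs := (1 - q ^+ 2 * expR (- y)) / _; set hw := _ / _ => hh.
have hs0 : 0 < hs.
  rewrite divr_gt0 // ?exprn_gt0 ?surv_den_gt0 //.
  have /andP[q0 q1] := q01; rewrite subr_gt0.
  have q21 : q ^+ 2 < 1 by rewrite exprn_ilt1.
  by apply: le_lt_trans q21; rewrite ler_piMr // exprn_ge0.
apply: (@lt_le_trans _ _ ((1 - expR (- (t * y))) * hs)).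
  by rewrite ltr_pM2r // expRN_scale.
by rewrite ler_wpM2l // subr_ge0.
Qed.

(** The slope is the value of the monotone ratio at s = 1, which is the inverse of the critical
    value of c. *)
Lemma surv_linear (y : R) : 0 <= y ->
  surv (expR (- y)) <= y * ((1 + q) / (1 - q)).
Proof.
move=> y0; have /andP[q0 q1] := q01.
have s01 := expRN_01 y0; have /andP[s0 s1] := s01.
rewrite survE // -(mulrA (1 - _)); apply: ler_pM.
- by rewrite subr_ge0.
- apply: divr_ge0; last by rewrite sqr_ge0.
  rewrite subr_ge0; apply: le_trans (_ : q ^+ 2 <= _).
    by rewrite ler_piMr // exprn_ge0.
  by rewrite exprn_ile1 // ltW.
- by have := @expR_ge1Dx _ (- y); lra.
- apply: le_trans (surv_ratio_mono s0 s1 (lexx _)) _; rewrite !mulr1.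
  rewrite le_eqVlt; apply/orP; left; apply/eqP; field.
  by rewrite gt_eqF // subr_gt0.
Qed.

Section FixedPoint.
Variables (c : R) (c0 : 0 < c).

Local Notation phi b := (surv (expR (- (c * b)))).

Lemma surv_fixpoint : exists2 beta : R, 0 <= beta & [/\ phi beta = beta,
  forall b, 0 <= b -> phi b = b -> b <= beta &
  forall b, beta < b -> phi b < b].
Proof.
pose A : set R := [set b : R | 0 <= b <= 1 /\ b <= phi b]%classic.
have phi0 : phi 0 = 0.
  rewrite mulr0 oppr0 expR0 /surv !mulr1 divff ?subrr //.
  by rewrite expf_neq0 // gt_eqF //; have := q01; lra.
have A0 : A 0 by rewrite /A /= phi0 lexx ler01.
have Aub : ubound A 1 by move=> b [/andP[]].
have Asup : has_sup A by split; [exists 0|exists 1].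
have le_sup b : A b -> b <= sup A by move=> Ab; apply: (ub_le_sup (proj2 Asup)).
have s0 : 0 <= sup A by apply: le_sup.
have s1 : sup A <= 1 by apply: ge_sup; first by exists 0.
have mono a b : 0 <= a -> a <= b -> phi a <= phi b.
  move=> a0 ab; apply: ler_surv; rewrite ?expR_ge0 //.
    by rewrite ler_expR lerN2 ler_pM2l.
  by case/andP: (expRN_01 (mulr_ge0 (ltW c0) a0)).
have ps : sup A <= phi (sup A).
  apply: ge_sup; first by exists 0.
  move=> b Ab; have [/andP[b0 b1] bb] := Ab.
  exact: le_trans bb (mono _ _ b0 (le_sup _ Ab)).
have Aps : A (phi (sup A)).
  split; last by apply: mono.
  by rewrite (le_trans s0 ps) surv_le // expR_ge0.
have above b : sup A < b -> phi b < b.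
  move=> sb; rewrite ltNge; apply/negP => bb.
  have b0 := le_lt_trans s0 sb.
  have : A b by split=> //; rewrite ltW //= (le_trans bb) // surv_le // expR_ge0.
  by move/le_sup; rewrite leNgt sb.
exists (sup A) => //; split=> //.
- by apply/eqP; rewrite eq_le ps le_sup.
- move=> b b0 bE; rewrite leNgt; apply/negP => /above.
  by rewrite bE ltxx.
Qed.

(** By [surv_scale], phi(mu)/mu does not increase with mu. *)
Lemma surv_above (b mu : R) : 0 < b -> b <= mu ->
  phi mu <= phi b / b * mu.
Proof.
move=> b0; rewrite le_eqVlt => /orP[/eqP <-|bmu].
  by rewrite divfK // gt_eqF.
have mu0 := lt_trans b0 bmu; rewrite mulrAC ler_pdivlMr // mulrC.
have t01 : 0 < b / mu < 1 by rewrite divr_gt0 //= ltr_pdivrMr // mul1r.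
have := surv_scale (mulr_gt0 c0 mu0) t01.
have -> : b / mu * (c * mu) = c * b by field; rewrite gt_eqF.
by rewrite mulrAC ltr_pdivrMr // => /ltW.
Qed.

Lemma surv_below (b mu : R) : 0 < mu -> mu <= b ->
  phi b / b * mu <= phi mu.
Proof.
move=> mu0 mub; have b0 := lt_le_trans mu0 mub.
have := surv_above mu0 mub; rewrite mulrAC ler_pdivlMr // => h.
by rewrite mulrAC ler_pdivrMr.
Qed.

End FixedPoint.
End SurvivalFunction.

(** * Concentration of the largest component *)

(** The bound is K N^(-gamma), a real power written with [expR] and [ln]. *)
Lemma cvg_exp_ln (R : realType) (u : nat -> R) (K gamma A : R) : 0 < gamma ->
  (forall N, A <= N%:R -> 0 <= u N <= K * expR (- (gamma * ln N%:R))) ->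
  (u N @[N --> \oo] --> (0 : R))%classic.
Proof.
move=> g0 uK; apply/cvgr0Pnorm_lt => eps eps0.
pose K' := `|K| + 1; have K'0 : 0 < K' by rewrite ltr_wpDl.
have KK' : K <= K' by rewrite /K'; have := ler_norm K; lra.
pose B := expR (ln (K' / eps) / gamma).
near=> N.
have AN : A <= N%:R by near: N; apply: nbhs_infty_ger.
have BN : B < N%:R by near: N; apply: nbhs_infty_gtr.
have /andP[u0 uN] := uK N AN.
have N0 : 0 < N%:R :> R by apply: lt_trans BN; apply: expR_gt0.
rewrite ger0_norm //; apply: (le_lt_trans uN).
apply: (@le_lt_trans _ _ (K' * expR (- (gamma * ln N%:R)))).
  by rewrite ler_wpM2r ?expR_ge0.
rewrite expRN ltr_pdivrMr ?expR_gt0 // mulrC -ltr_pdivrMr //.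
have Ke : 0 < K' / eps by rewrite divr_gt0.
rewrite -[ltLHS](lnK (_ : K' / eps \is Num.pos)) ?posrE // ltr_expR.
rewrite [ltRHS]mulrC -ltr_pdivrMr // -[ltLHS]expRK ltr_ln ?posrE ?expR_gt0 //.
Unshelve. all: by end_near. Qed.

(** The cube is the polynomial cost of the union bounds. Writing e^(ax) as a fourth power and using
    e^u >= u leaves a factor 1/x. *)
Lemma pow3_expR_le (R : realType) (a x : R) : 0 < a -> 0 < x ->
  x ^+ 3 * expR (- (a * x)) <= (4 / a) ^+ 4 * expR (- (1 * ln x)).
Proof.
move=> a0 x0; have y0 : 0 < a * x / 4 by rewrite !mulr_gt0 // invr_gt0.
have E : expR (a * x) = expR (a * x / 4) ^+ 4.
  by rewrite -expRM_natl; congr expR; field.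
rewrite mul1r !expRN lnK ?posrE // E ler_pdivrMr ?exprn_gt0 ?expR_gt0 //.
apply: (@le_trans _ _ ((4 / a) ^+ 4 / x * (a * x / 4) ^+ 4)).
  rewrite le_eqVlt; apply/orP; left; apply/eqP; field.
  by rewrite !gt_eqF.
apply: ler_wpM2l; first by rewrite divr_ge0 ?exprn_ge0 ?divr_ge0 // ltW.
apply: lerXn2r; rewrite ?nnegrE; [exact: ltW|exact: expR_ge0|].
by apply: le_trans (expR_ge1Dx _); rewrite lerDr.
Qed.

Section Concentration.
Variables (R : realType) (q c : R) (q01 : 0 <= q < 1) (c0 : 0 < c).

Local Notation P := (graph_prob q c).
Local Notation phi b := (surv q (expR (- (c * b)))).

Let weight_range N : 2 * c <= N%:R ->
  forall e : 'I_N * 'I_N,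
  0 <= (if (e.2 - e.1 == 1)%N then q else c / N%:R) <= 1.
Proof.
move=> cN e; have /andP[p0 p1] := edge_prob_range c0 cN.
have q01' := q01.
by case: ifP => _; [move: q01'|]; move=> *; lra.
Qed.

Lemma graph_prob_ge0 N (A : pred {set 'I_N * 'I_N}) : 2 * c <= N%:R -> 0 <= P A.
Proof.
move=> cN; rewrite graph_probE; apply: bern_mean_ge0 => [|G _].
  exact: weight_range.
exact: ler0n.
Qed.

Lemma graph_prob_le N (A B : pred {set 'I_N * 'I_N}) : 2 * c <= N%:R ->
  (forall G, graph_on G -> A G -> B G) -> P A <= P B.
Proof.
move=> cN AB; rewrite !graph_probE; apply: le_bern_mean => [|G GV].
  exact: weight_range.
by rewrite ler_nat; case: (boolP (A G)) => // /(AB G GV) ->.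
Qed.

Lemma graph_prob_union N (I : finType) (Q : pred I)
    (A : pred {set 'I_N * 'I_N}) (B : I -> pred {set 'I_N * 'I_N}) (K : R) :
  2 * c <= N%:R -> 0 <= K ->
  (forall G, graph_on G -> A G -> exists2 i, Q i & B i G) ->
  (forall i, Q i -> P (B i) <= K) ->
  P A <= #|I|%:R * K.
Proof.
move=> cN K0 AB BK.
apply: (@le_trans _ _ (\sum_(i | Q i) P (B i))).
  under [leRHS]eq_bigr do rewrite graph_probE.
  rewrite graph_probE -bern_mean_sum; apply: le_bern_mean => [|G GV].
    exact: weight_range.
  case: (boolP (A G)) => [AG|_]; last by rewrite sumr_ge0.
  have [i Qi BiG] := AB G GV AG.
  by rewrite (bigD1 i) //= BiG lerDl sumr_ge0.
apply: (le_trans (ler_sum _ BK)); rewrite sumr_const -[leLHS]mulr_natl.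
by rewrite ler_wpM2r // ler_nat max_card.
Qed.

Lemma card_connect N (G : {set 'I_N * 'I_N}) v :
  #|connect (adj G) v| = #|reach (adj G) setT%SET [set v]%SET|.
Proof.
apply: eq_card => u; rewrite !inE; apply/idP/existsP => [vu|[s]].
  exists v; rewrite set11 /=; apply: connect_sub vu => x y xy.
  by apply: connect1; rewrite /radj /= xy !inE.
rewrite inE => /andP[/eqP ->]; apply: connect_sub => x y /and3P[xy _ _].
exact: connect1.
Qed.

(** Converse of [expr_onem_le] up to 1 + eta in the exponent: with p = c/N, (1 - p)(1 + p(1 + eta))
    >= 1 as soon as p(1 + eta) <= eta. *)
Lemma survival_le_expR (eta : R) N m : 0 < eta ->
  2 * c + c * (1 + eta) / eta <= N%:R ->
  expR (- (c * (1 + eta) * (m%:R / N%:R))) <= (1 - c / N%:R) ^+ m.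
Proof.
move=> e0 cN; have c_gt0 := c0.
have ce : 0 < c * (1 + eta) / eta by rewrite divr_gt0 // mulr_gt0 //; lra.
have N0 : 0 < N%:R :> R by lra.
have /andP[p0 p1] : 0 < c / N%:R <= 1 / 2 by apply: edge_prob_range => //; lra.
have pe : c / N%:R * (1 + eta) <= eta.
  by rewrite mulrAC ler_pdivrMr // [leRHS]mulrC -ler_pdivrMr //; lra.
have -> : - (c * (1 + eta) * (m%:R / N%:R)) = m%:R * (- (c / N%:R * (1 + eta))).
  by ring.
set p := c / N%:R in p0 p1 pe *; rewrite expRM_natl; apply: lerXn2r.
- by rewrite nnegrE expR_ge0.
- by rewrite nnegrE; lra.
rewrite expRN -[leLHS]mul1r ler_pdivrMr ?expR_gt0 //.
apply: (@le_trans _ _ ((1 - p) * (1 + p * (1 + eta)))); last first.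
  by rewrite ler_wpM2l ?expR_ge1Dx //; lra.
have : p * (p * (1 + eta)) <= p * eta by rewrite ler_pM2l.
lra.
Qed.

(** Taking mu1 = 0 reaches sizes of order log N; mu1 > 0 serves sizes of order N. The choice of
    [eta] gives surv(r) <= phi((1 + eta) mu) <= (1 + eta) phi(mu) <= mu (1 + k)/2 for r = (1 -
    c/N)^m. The cube of N collects the N vertices, the N + 1 sizes and the factor N of
    [component_law_up]. *)
Lemma C1_upper (k mu1 : R) : 0 < k < 1 -> 0 <= mu1 ->
  (forall mu, 0 < mu -> mu1 <= mu -> phi mu <= k * mu) ->
  exists C delta A : R, [/\ 0 < C, 0 < delta, 0 < A &
  forall N (x : R), A <= N%:R -> 0 <= x -> mu1 * N%:R <= x ->
    P (fun G : {set 'I_N * 'I_N} => x < (C1 G)%:R) <=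
    C * N%:R ^+ 3 * expR (- (delta * x))].
Proof.
move=> /andP[k0 k1] mu10 phik; have c_gt0 := c0.
pose eta := (1 - k) / (2 * k).
have eta0 : 0 < eta by rewrite divr_gt0 //; lra.
have ek : (1 + eta) * k = (1 + k) / 2 by rewrite /eta; field; rewrite gt_eqF.
clearbody eta.
have kk : 0 < (1 + k) / 2 < 1 by lra.
have [C [delta [C0 d0 law]]] := component_law_up q01 c0 kk.
exists (2 * C), delta, (1 + (2 * c + c * (1 + eta) / eta)).
have ce : 0 < c * (1 + eta) / eta by rewrite divr_gt0 // mulr_gt0 //; lra.
split=> //; [by rewrite mulr_gt0| by lra|move=> N x AN x0 mux].
have N1 : 1 <= N%:R :> R by lra.
have Nn : (0 < N)%N by rewrite -(ltr0n R); lra.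
have cN : 2 * c <= N%:R by lra.
have K0 : 0 <= C * N%:R * expR (- (delta * x)).
  by rewrite !mulr_ge0 ?expR_ge0 // ltW.
pose Q (i : 'I_N * 'I_N.+1) := x < i.2%:R.
pose B (i : 'I_N * 'I_N.+1) (G : {set 'I_N * 'I_N}) :=
  #|reach (adj G) setT%SET [set i.1]%SET| == i.2.
have := @graph_prob_union N _ Q (fun G => x < (C1 G)%:R) B _ cN K0.
move=> /(_ _ _)/le_trans; apply.
- move=> G _ xG.
  have [v vE] : exists v, C1 G = #|connect (adj G) v|.
    have [|v vE] := @bigop.eq_bigmax _ (fun i : 'I_N => #|connect (adj G) i|).
      by rewrite card_ord.
    by exists v.
  have cv : (#|connect (adj G) v| < N.+1)%N.
    by rewrite ltnS -[leqRHS]card_ord max_card.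
  exists (v, Ordinal cv); first by rewrite /Q /= -vE.
  by rewrite /B /= card_connect.
- move=> [v m] /= xm; rewrite /Q /= in xm.
  have m0 : (0 < m)%N by rewrite -(ltr0n R); lra.
  have mN : (m <= N)%N by rewrite -ltnS.
  apply: le_trans (law N m v cN _ _) _.
  + by rewrite m0.
  + set r := (1 - c / N%:R) ^+ m.
    have /andP[p0 p1] := edge_prob_range c0 cN.
    have r0 : 0 <= r by rewrite exprn_ge0 //; lra.
    have r1 : r <= 1 by rewrite exprn_ile1 //; lra.
    have r01 : 0 <= r <= 1 by rewrite r0.
    rewrite -ler_pdivrMr ?exprn_gt0 ?surv_den_gt0 // -survE //.
    set mu := m%:R / N%:R.
    have mu0 : 0 < mu by rewrite divr_gt0 ?ltr0n.
    apply: (@le_trans _ _ (surv q (expR (- (c * (1 + eta) * mu))))).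
      apply: ler_surv => //; rewrite ?expR_ge0 //.
      by apply: survival_le_expR => //; lra.
    apply: (@le_trans _ _ ((1 + eta) * phi mu)); last first.
      rewrite -ek -mulrA ler_pM2l; last by lra.
      apply: phik => //; rewrite /mu ler_pdivlMr //; last by lra.
      by apply: (le_trans mux); lra.
    have y0 : 0 < c * (1 + eta) * mu by rewrite mulr_gt0 // mulr_gt0 //; lra.
    have t01 : 0 < (1 + eta)^-1 < 1.
      by rewrite invr_gt0 invf_lt1; lra.
    have := surv_scale q01 y0 t01.
    have -> : (1 + eta)^-1 * (c * (1 + eta) * mu) = c * mu.
      by field; rewrite gt_eqF //; lra.
    by rewrite mulrC ltr_pdivrMr ?[_ * (1 + eta)]mulrC; [move/ltW|lra].
  + apply: ler_wpM2l; first by rewrite mulr_ge0 // ltW.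
    by rewrite ler_expR lerN2 ler_pM2l // ltW.
rewrite card_prod !card_ord natrM.
set E := expR _; have E0 : 0 <= E by rewrite expR_ge0.
rewrite [leRHS](_ : _ = N%:R * (2 * N%:R) * (C * N%:R * E)); last by ring.
apply: ler_wpM2r => //; apply: ler_wpM2l; first by lra.
by rewrite -natr1; lra.
Qed.

Lemma reachU (N : nat) (G : {set 'I_N * 'I_N}) (S S' : {set 'I_N}) :
  reach (adj G) setT%SET (S :|: S') =
  reach (adj G) setT%SET S :|: reach (adj G) setT%SET S'.
Proof.
apply/setP => v; rewrite in_setU; apply/reachP/orP.
  by move=> [s /setUP[sS|sS] sv]; [left|right]; apply/reachP; exists s.
by move=> [|] /reachP[s sS sv]; exists s => //; rewrite in_setU sS ?orbT.
Qed.

(* Adding the sources one by one increases the explored set by at most [C1 G]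
   at each step, so a gap in its sizes forces a large component. *)
Lemma C1_gap (N : nat) (G : {set 'I_N * 'I_N}) (a b : R) :
  0 < a -> a <= N%:R -> (C1 G)%:R < b - a ->
  exists j : 'I_N.+1,
    a <= #|reach (adj G) setT%SET [set v : 'I_N | (v < j)%N]%SET|%:R <= b.
Proof.
move=> a0 aN Cab.
pose f j := #|reach (adj G) setT%SET [set v : 'I_N | (v < j)%N]%SET|.
have f0 : f 0%N = 0%N.
  have S0 : [set v : 'I_N | (v < 0)%N]%SET = finset.set0.
    by apply/finset.setP => v; rewrite !inE.
  by rewrite /f S0 reach0 cards0.
have fN : (N <= f N)%N.
  rewrite -[leqLHS]card_ord -cardsT; apply: subset_leq_card.
  apply: subset_trans (sub_reach _ _ _); apply/fintype.subsetP => v _.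
  by rewrite inE ltn_ord.
have fS j : (j < N)%N -> (f j.+1 <= f j + C1 G)%N.
  move=> jN; rewrite /f.
  have -> : [set v : 'I_N | (v < j.+1)%N]%SET =
      [set v : 'I_N | (v < j)%N]%SET :|: [set Ordinal jN]%SET.
    by apply/setP => v; rewrite !inE -val_eqE /= ltnS leq_eqVlt orbC.
  rewrite reachU; apply: leq_trans (leq_card_setU _ _) _.
  rewrite leq_add2l -card_connect.
  exact: (@bigop.leq_bigmax _ (fun i : 'I_N => #|connect (adj G) i|)).
have ex : exists j, a <= (f j)%:R.
  by exists N; apply: le_trans aN _; rewrite ler_nat.
have jmin := ex_minnP ex; case: jmin => j aj minj.
have j0 : (0 < j)%N.
  by rewrite lt0n; apply/eqP => j0; move: aj; rewrite j0 f0; lra.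
have jN : (j <= N)%N.
  by apply: minj; apply: le_trans aN _; rewrite ler_nat.
exists (Ordinal (jN : (j < N.+1)%N)); rewrite aj /=.
have fj1 : (f j.-1)%:R < a.
  by rewrite ltNge; apply/negP => /minj; rewrite leqNgt prednK ?leqnn.
have := fS j.-1; rewrite prednK // => /(_ jN).
by rewrite -(ler_nat R) natrD; rewrite -/(f j); lra.
Qed.

Lemma C1_lower (beta eps : R) : 0 < eps < beta -> phi beta = beta ->
  exists C delta A : R, [/\ 0 < C, 0 < delta, 0 < A &
  forall N, A <= N%:R ->
    P (fun G : {set 'I_N * 'I_N} => (C1 G)%:R < (beta - eps) * N%:R) <=
    C * N%:R ^+ 3 * expR (- (delta * N%:R))].
Proof.
move=> /andP[e0 eb] phib; have c_gt0 := c0.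
have b1 : beta <= 1 by rewrite -phib surv_le // expR_ge0.
(* The gap mu2 - mu0 = beta - 3 eps/4 exceeds beta - eps, so no component below (beta - eps) N can
   jump over it; and mu2 < beta makes [k] larger than 1. *)
pose mu2 := beta - eps / 2; pose mu0 := eps / 4.
have mu00 : 0 < mu0 by rewrite /mu0; lra.
have mu20 : 0 < mu2 by rewrite /mu2; lra.
have mu2b : mu2 < beta by rewrite /mu2; lra.
pose k := phi mu2 / mu2.
have k1 : 1 < k.
  rewrite /k ltr_pdivlMr // mul1r.
  have b0 : 0 < beta by lra.
  have t01 : 0 < mu2 / beta < 1 by rewrite divr_gt0 //= ltr_pdivrMr // mul1r.
  have := surv_scale q01 (mulr_gt0 c0 b0) t01.
  rewrite phib divfK ?gt_eqF //.
  by have -> : mu2 / beta * (c * beta) = c * mu2 by field; rewrite gt_eqF.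
have [C [delta [C0 d0 law]]] := component_law_down q01 c0 k1.
exists (4 * C), (delta * mu0), (1 + 2 * c).
split=> //; [by rewrite mulr_gt0|by rewrite mulr_gt0|by lra|move=> N AN].
have N1 : 1 <= N%:R :> R by lra.
have Nn : (0 < N)%N by rewrite -(ltr0n R); lra.
have cN : 2 * c <= N%:R by lra.
have K0 : 0 <= C * expR (- (delta * mu0 * N%:R)).
  by rewrite mulr_ge0 ?expR_ge0 // ltW.
pose Q (i : 'I_N.+1 * 'I_N.+1) := mu0 * N%:R <= i.2%:R <= mu2 * N%:R.
pose B (i : 'I_N.+1 * 'I_N.+1) (G : {set 'I_N * 'I_N}) :=
  #|reach (adj G) setT%SET [set v : 'I_N | (v < i.1)%N]%SET| == i.2.
have := @graph_prob_union N _ Q (fun G => (C1 G)%:R < (beta - eps) * N%:R) B _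
  cN K0.
move=> /(_ _ _)/le_trans; apply.
- move=> G _ xG.
  have [||| j jP] := @C1_gap N G (mu0 * N%:R) (mu2 * N%:R).
  + by rewrite mulr_gt0 //; lra.
  + by rewrite ler_piMl //; rewrite /mu0; lra.
  + apply: (lt_le_trans xG); rewrite -mulrBl ler_wpM2r //.
    by rewrite /mu2 /mu0; lra.
  have cv : (#|reach (adj G) setT%SET [set v : 'I_N | (v < j)%N]%SET| < N.+1)%N.
    by rewrite ltnS -[leqRHS]card_ord max_card.
  by exists (j, Ordinal cv); rewrite ?/Q ?/B.
- move=> [j m] /andP[/= am mb].
  have m0 : (0 < m)%N.
    by rewrite -(ltr0n R); apply: lt_le_trans am; rewrite mulr_gt0 //; lra.
  have mN : (m <= N)%N by rewrite -ltnS.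
  apply: le_trans (law N m _ cN _ _) _.
  + by rewrite m0.
  + set r := (1 - c / N%:R) ^+ m.
    have /andP[p0 p1] := edge_prob_range c0 cN.
    have r0 : 0 <= r by rewrite exprn_ge0 //; lra.
    have r1 : r <= 1 by rewrite exprn_ile1 //; lra.
    have r01 : 0 <= r <= 1 by rewrite r0.
    rewrite -ler_pdivlMr ?exprn_gt0 ?surv_den_gt0 // -survE //.
    set mu := m%:R / N%:R.
    have mu_gt0 : 0 < mu by rewrite divr_gt0 ?ltr0n.
    have mu_le : mu <= mu2 by rewrite ler_pdivrMr //; lra.
    apply: (le_trans (surv_below q01 c0 mu_gt0 mu_le)).
    (* Here (1 - c/N)^m <= e^(-c mu) already goes in the right direction. *)
    apply: ler_surv => //.
      have -> : c * mu = m%:R * (c / N%:R) by rewrite /mu; ring.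
      by apply: expr_onem_le; lra.
    by rewrite -expR0 ler_expR oppr_le0 mulr_ge0 // ltW.
  + apply: ler_wpM2l; first exact: ltW.
    by rewrite ler_expR lerN2 -mulrA ler_pM2l.
rewrite card_prod !card_ord natrM.
set E := expR _; have E0 : 0 <= E by rewrite expR_ge0.
rewrite [leRHS](_ : _ = 2 * N%:R * (2 * N%:R) * (C * N%:R * E)); last by ring.
have NN : N.+1%:R <= 2 * N%:R :> R by rewrite -natr1; lra.
have CE : C * E <= C * N%:R * E.
  by apply: ler_wpM2r => //; rewrite ler_peMr // ltW.
by apply: ler_pM => //; apply: ler_pM.
Qed.

End Concentration.

(** * Long runs of short edges *)

Section LongRuns.
Variables (N L : nat).
Implicit Types (G : {set 'I_N * 'I_N}).

Definition run_block (i : nat) : {set 'I_N * 'I_N} :=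
  [set e in short_pairs N | (i * L.+1 <= e.1)%N && (e.2 < i.+1 * L.+1)%N]%SET.

Lemma run_block_disjoint i j : i != j -> [disjoint run_block i & run_block j].
Proof.
move=> ij; rewrite -setI_eq0; apply/eqP/finset.setP => -[a b].
rewrite !inE /=; apply/negbTE/negP.
move=> /andP[/andP[/andP[ab _] /andP[ia bi]] /andP[_ /andP[ja bj]]].
move: ij; rewrite neq_ltn => /orP[] ij.
  have := leq_mul ij (leqnn L.+1); lia.
have := leq_mul ij (leqnn L.+1); lia.
Qed.

Lemma card_run_block i : (#|run_block i| <= L)%N.
Proof.
rewrite cardE -(size_map (fun e => val e.1)) -[leqRHS](size_iota (i * L.+1)).
apply: uniq_leq_size => [|x /mapP[[a b]]].
  rewrite map_inj_in_uniq ?enum_uniq // => -[a b] [a' b'] /=.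
  rewrite !mem_enum !inE /= => /andP[/andP[ab /eqP b1] _].
  move=> /andP[/andP[ab' /eqP b1'] _] aa'.
  by congr pair; apply: val_inj => /=; lia.
rewrite mem_enum !inE /= => /andP[/andP[ab /eqP b1] /andP[ia bi]] ->.
by rewrite mem_iota; lia.
Qed.

Lemma C1_run_block G i : (i.+1 * L.+1 <= N)%N -> run_block i \subset G ->
  (L.+1 <= C1 G)%N.
Proof.
move=> iN /fintype.subsetP BG.
have iLN (k : nat) : (k < L.+1)%N -> (i * L.+1 + k < N)%N.
  by move: iN; rewrite mulSn; lia.
pose f (k : 'I_L.+1) : 'I_N := Ordinal (iLN k (ltn_ord k)).
have f_inj : injective f by move=> k k' [] ?; apply: val_inj => /=; lia.
have conn k (kL : (k < L.+1)%N) :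
    connect (adj G) (f ord0) (Ordinal (iLN k kL)).
  elim: k kL => [|k IHk] kL.
    by rewrite (_ : Ordinal _ = f ord0) ?connect0 //; apply: val_inj.
  apply: connect_trans (IHk (ltnW kL)) (connect1 _).
  rewrite /adj /=; apply/orP; left; apply: BG; rewrite !inE /=.
  by move: iN; rewrite mulSn; lia.
rewrite -[leqLHS]card_ord -(card_imset _ f_inj).
apply: (@leq_trans #|connect (adj G) (f ord0)|).
  apply: subset_leq_card; apply/fintype.subsetP => v /imsetP[k _ ->].
  exact: conn.
exact: (@bigop.leq_bigmax _ (fun i : 'I_N => #|connect (adj G) i|)).
Qed.

(** A block of L + 1 consecutive vertices is fully linked with probability at least q^L,
    independently for disjoint blocks, and all of them must fail. *)
Lemma C1_runs_prob (R : realType) (q c : R) : 0 <= q < 1 -> 0 < c ->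
  2 * c <= N%:R ->
  graph_prob q c (fun G : {set 'I_N * 'I_N} => (C1 G < L.+1)%N) <=
  expR (- ((N %/ L.+1)%:R * q ^+ L)).
Proof.
move=> q01 c0 cN; have /andP[q0 q1] := q01; rewrite graph_probE.
set w := (fun e : 'I_N * 'I_N => _).
have w01 e : 0 <= w e <= 1.
  have /andP[p0 p1] := edge_prob_range c0 cN.
  by rewrite /w; case: ifP => _; lra.
set M := (N %/ L.+1)%N.
apply: (@le_trans _ _ (bern_mean w (vpairs N) (fun G =>
    \prod_(i < M | i \in [set: 'I_M]%SET) (1 - (run_block i \subset G)%:R)))).
  apply: (le_bern_mean w01) => G _; case: ltnP => CG; last first.
    by apply: prodr_ge0 => i _; case: (_ \subset _); rewrite ?subrr ?subr0.
  rewrite big1 // => i _.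
  have iN : (i.+1 * L.+1 <= N)%N.
    by apply: leq_trans (leq_divM N L.+1); rewrite leq_mul2r ltn_ord orbT.
  case: (boolP (run_block i \subset G)) => [/(C1_run_block iN)|_].
    by rewrite leqNgt CG.
  by rewrite subr0.
rewrite (@bern_mean_prod _ _ _ _ _ _ (fun i : 'I_M => run_block i)); first last.
- by move=> i G _ _; rewrite subsetI subxx andbT.
- by move=> i j _ _ ij; apply: run_block_disjoint.
- move=> i _; apply/fintype.subsetP => e; rewrite !inE.
  by move=> /andP[/andP[]].
have -> : expR (- (M%:R * q ^+ L)) =
    \prod_(i < M | i \in [set: 'I_M]%SET) expR (- q ^+ L).
  rewrite (eq_bigl predT) => [|i]; last by rewrite inE.
  by rewrite prodr_const card_ord -mulrN expRM_natl.
apply: ler_prod => i _.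
have -> : bern_mean w (vpairs N) (fun G => 1 - (run_block i \subset G)%:R) =
    1 - q ^+ #|run_block i|.
  transitivity (bern_mean w (vpairs N)
      (fun G => 1 + (-1) * (run_block i \subset G)%:R)).
    by apply: eq_bern_mean => G _; ring.
  rewrite bern_meanD bern_mean_cst bern_meanZ bern_mean_subset; last first.
    by apply/fintype.subsetP => e; rewrite !inE => /andP[/andP[]].
  rewrite (eq_bigr (fun=> q)) ?prodr_const; first by ring.
  by move=> e; rewrite /w !inE => /andP[/andP[_ ->]].
rewrite subr_ge0 exprn_ile1 //=; last exact: ltW.
apply: (@le_trans _ _ (1 - q ^+ L)).
  rewrite lerB //; apply: ler_wiXn2l => //; first exact: ltW.
  exact: card_run_block.
exact: expR_ge1Dx.
Qed.

End LongRuns.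

Local Open Scope classical_set_scope.
Local Open Scope ring_scope.

(** A block of length about alpha1 log N is fully linked with probability at least N^(-a), a =
    alpha1 |log q| < 1, and there are of order N / log N blocks, so the expected number of full ones
    is at least of order N^(1 - a) / log N, which tends to infinity. *)
Lemma C1_log_lower (R : realType) (q c alpha1 : R) : 0 <= q < 1 -> 0 < c ->
  alpha1 < inv_abs_log q ->
  graph_prob q c
    (fun G : {set 'I_N * 'I_N} => (C1 G)%:R < alpha1 * ln (N%:R : R))
    @[N --> \oo] --> (0 : R).
Proof.
move=> q01 c0 aq; have /andP[q0 q1] := q01.
(* For alpha1 <= 0 the event is empty; this disposes of q = 0, where [inv_abs_log q] is 0. *)
have [a0|a0] := leP alpha1 0.
  apply: (@cvg_exp_ln _ _ 0 1 (1 + 2 * c)) => // N AN.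
  have cN : 2 * c <= N%:R by lra.
  rewrite graph_prob_ge0 //= mul0r.
  apply: (@le_trans _ _ (graph_prob q c (fun G : {set 'I_N * 'I_N} => false))).
    apply: graph_prob_le => // G _; rewrite ltNge => /negP[].
    apply: (@le_trans _ _ 0) => //; rewrite mulr_le0_ge0 // ln_ge0 //; lra.
  by rewrite graph_probE /bern_mean big1 // => G _; rewrite mulr0.
have qn0 : q != 0.
  by apply: contraTneq aq => ->; rewrite /inv_abs_log eqxx -leNgt ltW.
have q_gt0 : 0 < q by rewrite lt_neqAle eq_sym qn0.
have lnq : ln q < 0 by apply: ln_lt0; rewrite q_gt0.
pose a := alpha1 * - ln q.
have a1 : a < 1.
  move: aq; rewrite /inv_abs_log (negPf qn0) ltr0_norm // ltr_pdivlMr //.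
  by rewrite oppr_gt0.
(* Half of the slack 1 - a pays for the logarithmic block length, the other half is the rate
   N^(-b). *)
pose b := (1 - a) / 2; have b0 : 0 < b by rewrite /b; lra.
have aE : a = 1 - 2 * b by rewrite /b; field.
clearbody b.
pose K := expR 1 * (alpha1 / b + 1).
apply: (@cvg_exp_ln _ _ K b (1 + 2 * c)) => // N AN.
have cN : 2 * c <= N%:R by lra.
rewrite graph_prob_ge0 //=.
set x := ln N%:R; have N0 : 0 < N%:R :> R by lra.
have x0 : 0 <= x by rewrite ln_ge0 //; lra.
have NE : N%:R = expR x by rewrite lnK.
have ax0 : 0 <= alpha1 * x by rewrite mulr_ge0 // ltW.
pose L := Num.truncn (alpha1 * x).
have /andP[L1 L2] : L%:R <= alpha1 * x < L.+1%:R by rewrite truncn_itv.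
apply: (@le_trans _ _ (graph_prob q c
    (fun G : {set 'I_N * 'I_N} => (C1 G < L.+1)%N))).
  apply: graph_prob_le => // G _ Ca.
  by rewrite -(ltr_nat R); apply: lt_trans L2.
apply: (le_trans (C1_runs_prob L q01 c0 cN)).
set M := (N %/ L.+1)%N; set Q := q ^+ L.
have Q0 : 0 < Q by rewrite exprn_gt0.
have Q1 : Q <= 1 by rewrite exprn_ile1 // ltW.
have Qge : expR (- (a * x)) <= Q.
  rewrite /Q -[q](lnK (_ : q \is Num.pos)) ?posrE // -expRM_natl ler_expR.
  have -> : - (a * x) = alpha1 * x * ln q by rewrite /a; ring.
  by apply: ler_wnM2r => //; exact: ltW.
have ML : N%:R <= (M%:R + 1) * L.+1%:R :> R.
  by rewrite natr1 -natrM ler_nat ltnW // ltn_ceil.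
have Lle : L.+1%:R <= (alpha1 / b + 1) * expR (b * x).
  have bx : b * x <= expR (b * x) by have := expR_ge1Dx (b * x); lra.
  have bx1 : 1 <= expR (b * x) by rewrite -expR0 ler_expR mulr_ge0 // ltW.
  rewrite -natr1 mulrDl mul1r lerD //; apply: (le_trans L1).
  have -> : alpha1 * x = alpha1 / b * (b * x) by field; rewrite gt_eqF.
  by apply: ler_wpM2l => //; rewrite divr_ge0 // ltW.
have L0 : 0 < L.+1%:R :> R by rewrite ltr0n.
(* The quotient [M] is rounded down; as Q <= 1, passing to M + 1, which is at least N/(L + 1), costs
   a factor e. *)
apply: (@le_trans _ _ (expR 1 * expR (- ((M%:R + 1) * Q)))).
  by rewrite -expRD ler_expR mulrDl mul1r; lra.
rewrite -mulrA; apply: ler_wpM2l; first exact: expR_ge0.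
apply: (@le_trans _ _ ((M%:R + 1) * Q)^-1).
  have MQ : 0 < (M%:R + 1) * Q by rewrite mulr_gt0 // ltr_wpDl.
  rewrite expRN lef_pV2 ?posrE ?expR_gt0 //.
  by apply: le_trans (expR_ge1Dx _); rewrite lerDr.
apply: (@le_trans _ _ (N%:R / L.+1%:R * expR (- (a * x)))^-1).
  rewrite lef_pV2 ?posrE ?mulr_gt0 ?invr_gt0 ?expR_gt0 ?ltr_wpDl //.
  by apply: ler_pM => //; rewrite ?expR_ge0 ?divr_ge0 ?ler_pdivrMr // ltW.
rewrite !invfM invrK -expRN opprK NE -expRN.
apply: (@le_trans _ _ (expR (- x) * ((alpha1 / b + 1) * expR (b * x)) *
    expR (a * x))).
  apply: ler_wpM2r; first exact: expR_ge0.
  by apply: ler_wpM2l => //; exact: expR_ge0.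
rewrite le_eqVlt; apply/orP; left; apply/eqP.
rewrite [LHS](_ : _ = (alpha1 / b + 1) *
  (expR (- x) * expR (b * x) * expR (a * x))); last by ring.
by rewrite -!expRD; congr (_ * expR _); rewrite aE; ring.
Qed.

(** * Moments of the geometric law *)

From mathcomp Require Import classical_sets.

Section GeometricMoments.
Variable R : realType.

Lemma cvg_poly_expr (t : R) (k : nat) : 0 <= t < 1 -> (k <= 3)%N ->
  (n%:R ^+ k * t ^+ n) @[n --> \oo] --> (0 : R).
Proof.
move=> /andP[t0 t1] k3; move: t0; rewrite le_eqVlt => /orP[/eqP <-|t0].
  apply: (@cvg_exp_ln _ _ 0 1 1) => // N N1.
  have Nn : (0 < N)%N by rewrite -(ltr0n R); lra.
  by rewrite expr0n -leqn0 leqNgt Nn mulr0 mul0r lexx.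
have a0 : 0 < - ln t by rewrite oppr_gt0 ln_lt0 ?t0.
apply: (@cvg_exp_ln _ _ ((4 / - ln t) ^+ 4) 1 1) => // N N1.
have N0 : 0 < N%:R :> R by lra.
rewrite mulr_ge0 ?exprn_ge0 //=; last exact: ltW.
apply: le_trans (pow3_expR_le a0 N0).
have -> : t ^+ N = expR (- (- ln t * N%:R)).
  by rewrite -[t in LHS](lnK (_ : t \is Num.pos)) ?posrE // -expRM_natl;
    congr expR; ring.
by rewrite ler_wpM2r ?expR_ge0 // ler_weXn2l.
Qed.

Lemma cvg_series_linear (t : R) : 0 <= t < 1 ->
  series (fun k => k.+1%:R * t ^+ k) n @[n --> \oo] --> (1 - t) ^- 2.
Proof.
move=> t01; have t1 : 1 - t != 0 by rewrite gt_eqF //; move: t01; lra.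
(* Closed form of the partial sums; the power [^+ 0] is kept so that both corrections are instances
   of [cvg_poly_expr]. *)
have -> : (fun n => series (fun k => k.+1%:R * t ^+ k) n) =
  (fun n => (1 - t) ^- 2 - ((1 - t) ^- 2 * (n%:R ^+ 0 * t ^+ n) +
     (1 - t)^-1 * (n%:R ^+ 1 * t ^+ n))).
  apply/funext => n; rewrite seriesEord /=; elim: n => [|n IHn].
    by rewrite big_ord0 !expr0; field.
  by rewrite big_ord_recr /= IHn (exprS t) -natr1; field.
rewrite -[X in _ --> X]subr0; apply: cvgB; first exact: cvg_cst.
rewrite -[X in _ --> X]addr0; apply: cvgD.
  by rewrite -(mulr0 ((1 - t) ^- 2)); apply: cvgMr; apply: cvg_poly_expr.
by rewrite -(mulr0 (1 - t)^-1); apply: cvgMr; apply: cvg_poly_expr.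
Qed.

Lemma cvg_series_square (t : R) : 0 <= t < 1 ->
  series (fun k => k.+1%:R ^+ 2 * t ^+ k) n @[n --> \oo] -->
  (1 + t) / (1 - t) ^+ 3.
Proof.
move=> t01; have t1 : 1 - t != 0 by rewrite gt_eqF //; move: t01; lra.
have -> : (fun n => series (fun k => k.+1%:R ^+ 2 * t ^+ k) n) =
  (fun n => (1 + t) / (1 - t) ^+ 3 -
    ((1 + t) / (1 - t) ^+ 3 * (n%:R ^+ 0 * t ^+ n) +
     (2 / (1 - t) ^+ 2 * (n%:R ^+ 1 * t ^+ n) +
      (1 - t)^-1 * (n%:R ^+ 2 * t ^+ n)))).
  apply/funext => n; rewrite seriesEord /=; elim: n => [|n IHn].
    by rewrite big_ord0 !expr0; field.
  by rewrite big_ord_recr /= IHn (exprS t) -natr1; field.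
rewrite -[X in _ --> X]subr0; apply: cvgB; first exact: cvg_cst.
rewrite -[X in _ --> X]addr0; apply: cvgD.
  rewrite -(mulr0 ((1 + t) / (1 - t) ^+ 3)).
  by apply: cvgMr; apply: cvg_poly_expr.
rewrite -[X in _ --> X]addr0; apply: cvgD.
  by rewrite -(mulr0 (2 / (1 - t) ^+ 2)); apply: cvgMr; apply: cvg_poly_expr.
by rewrite -(mulr0 (1 - t)^-1); apply: cvgMr; apply: cvg_poly_expr.
Qed.

Lemma eseries_cvg (u : R^nat) (l : R) :
  series u n @[n --> \oo] --> l ->
  (\sum_(0 <= k <oo) (u k)%:E)%E = l%:E.
Proof.
move=> ul; apply/cvg_lim => //.
have -> : (fun n => \sum_(0 <= k < n) (u k)%:E)%E = EFin \o series u.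
  by apply/funext => n; rewrite /= sumEFin.
by apply/fine_cvgP; split; first exact: nearW.
Qed.

Variables (q : R) (q01 : 0 <= q < 1).
Variables (d : measure_display) (T : measurableType d) (P : probability T R).
Variables (X : {RV P >-> R}) (hX : geometric_law q X).

Let A (k : nat) : set T := X @^-1` [set k.+1%:R].

Let mA k : measurable (A k).
Proof. by rewrite -[A k]setTI; apply: measurable_funP. Qed.

Let tA : trivIset setT A.
Proof.
apply/trivIsetP => i j _ _ ij; apply/seteqP; split => // t [].
rewrite /A /= => -> /eqP; rewrite eqr_nat eqSS => /eqP ijE.
by rewrite ijE eqxx in ij.
Qed.

Let PA k : P (A k) = ((1 - q) * q ^+ k)%:E.
Proof. by rewrite /A hX. Qed.

Let PD : P (\bigcup_k A k) = 1%E.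
Proof.
rewrite measure_bigcup //= (eq_eseriesl (Q := xpredT)) => [|k]; last first.
  by rewrite in_setT.
rewrite (eq_eseriesr (g := fun k => ((1 - q) * q ^+ k)%:E)) => [|k _]; last first.
  exact: PA.
rewrite (@eseries_cvg _ 1) //.
have q1 : `|q| < 1 by rewrite ger0_norm; move: q01; lra.
have := @cvg_geometric_series R (1 - q) q q1.
by rewrite mulfV // gt_eqF //; move: q01; lra.
Qed.

(** The masses add up to 1, so the values of X other than positive integers form a null event, and
    the integral is a sum over the level sets of X. *)
Lemma expectation_geometric (g : T -> R) (f : nat -> R) (l : R) :
  measurable_fun setT g ->
  (forall k, 0 <= f k.+1) ->
  (forall k t, X t = k.+1%:R -> g t = f k.+1) ->
  series (fun k => f k.+1 * ((1 - q) * q ^+ k)) n @[n --> \oo] --> l ->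
  ('E_P[g] = l%:E)%E.
Proof.
move=> mg f0 gf sl; pose D := \bigcup_k A k.
have mD : measurable D by apply: bigcup_measurable => k _; apply: mA.
have /measurable_EFinP mg' := mg.
rewrite unlock -(eseries_cvg sl).
transitivity (\int[P]_(t in D) (g t)%:E)%E; last first.
  rewrite ge0_integral_bigcup //.
  - apply: eq_eseriesr => k _.
    rewrite (eq_integral (cst (f k.+1)%:E)) => [|t].
      by rewrite integral_cst // EFinM; congr (_ * _)%E; exact: PA.
    by rewrite inE /A /= => /gf ->.
  - exact: measurable_funTS.
  - by move=> t [k _ /gf ->]; rewrite lee_fin.
rewrite [RHS]integral_mkcond; apply: ae_eq_integral => //.
  by apply/(measurable_restrictT _ _).1 => //; apply: measurable_funTS.
have PDc : P (~` D) = 0%E.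
  by rewrite probability_setC //; rewrite PD subee.
exists (~` D); split; [exact: measurableC|exact: PDc|].
move=> t /=; apply: contra_not => /= Dt _.
by rewrite patchE ifT // inE; apply: contrapT.
Qed.

Lemma expectation_geometric1 : ('E_P[X] = (1 - q)^-1%R%:E)%E.
Proof.
have q1 : 1 - q != 0 by rewrite gt_eqF //; move: q01; lra.
apply: (@expectation_geometric _ (fun k => k%:R)) => //.
have -> : (1 - q)^-1 = (1 - q) * (1 - q) ^- 2 by field.
have -> : (fun n => series (fun k => k.+1%:R * ((1 - q) * q ^+ k)) n) =
    (fun n => (1 - q) * series (fun k => k.+1%:R * q ^+ k) n).
  apply/funext => n; rewrite !seriesEord /= big_distrr /=.
  by apply: eq_bigr => k _; ring.
by apply: cvgMr; apply: cvg_series_linear.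
Qed.

Lemma expectation_geometric2 :
  ('E_P[(fun t => X t ^+ 2)%R] = ((1 + q) / (1 - q) ^+ 2)%R%:E)%E.
Proof.
have q1 : 1 - q != 0 by rewrite gt_eqF //; move: q01; lra.
apply: (@expectation_geometric _ (fun k => k%:R ^+ 2)).
- exact: measurable_funX.
- by move=> k; rewrite exprn_ge0.
- by move=> k t ->.
have -> : (1 + q) / (1 - q) ^+ 2 = (1 - q) * ((1 + q) / (1 - q) ^+ 3) by field.
have -> : (fun n => series (fun k => k.+1%:R ^+ 2 * ((1 - q) * q ^+ k)) n) =
    (fun n => (1 - q) * series (fun k => k.+1%:R ^+ 2 * q ^+ k) n).
  apply/funext => n; rewrite !seriesEord /= big_distrr /=.
  by apply: eq_bigr => k _; ring.
by apply: cvgMr; apply: cvg_series_square.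
Qed.

Lemma expectation_geometric_exp (c b : R) (s := expR (- (c * b))) :
  0 <= c * b ->
  ('E_P[(fun t => X t * expR (- (c * X t * b)))%R] =
   ((1 - q) * s / (1 - q * s) ^+ 2)%R%:E)%E.
Proof.
move=> cb; have /andP[s0 s1] := expRN_01 cb; have q01' := q01.
have qs : 0 <= q * s < 1.
  apply/andP; split; first by rewrite mulr_ge0 //; lra.
  by apply: le_lt_trans (_ : q < 1); [rewrite ler_piMr //; lra|lra].
apply: (@expectation_geometric _ (fun k => k%:R * s ^+ k)).
- apply: measurable_funM => //; apply: measurableT_comp => //.
  apply: measurableT_comp => //; apply: measurable_funM => //.
  exact: measurable_funM.
- by move=> k; rewrite mulr_ge0 // exprn_ge0.
- by move=> k t ->; rewrite /s -expRM_natl; congr (_ * expR _); ring.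
have -> : (fun n => series (fun k => k.+1%:R * s ^+ k.+1 *
      ((1 - q) * q ^+ k)) n) =
    (fun n => ((1 - q) * s) * series (fun k => k.+1%:R * (q * s) ^+ k) n).
  apply/funext => n; rewrite !seriesEord /= big_distrr /=.
  by apply: eq_bigr => k _; rewrite exprMn exprS; ring.
by apply: cvgMr; apply: cvg_series_linear.
Qed.

Lemma c_cr_geometric : c_cr X = (1 - q) / (1 + q).
Proof.
rewrite /c_cr expectation_geometric1 expectation_geometric2 /=; field.
by rewrite !gt_eqF //; move: q01; lra.
Qed.

Lemma beta_solution_geometric (c b : R) : 0 < c -> 0 <= b ->
  beta_solution c X b <-> surv q (expR (- (c * b))) = b.
Proof.
move=> c0 b0; have q01' := q01.
have cb : 0 <= c * b by rewrite mulr_ge0 // ltW.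
rewrite /beta_solution expectation_geometric1 expectation_geometric_exp //=.
have /andP[s0 s1] := expRN_01 cb.
set s := expR _ in s0 s1 *.
have qs : 0 < 1 - q * s by apply: surv_den_gt0 => //; rewrite s0.
have sE : 1 - 1 / (1 - q)^-1 * ((1 - q) * s / (1 - q * s) ^+ 2) = surv q s.
  by rewrite /surv; field; rewrite !gt_eqF //; lra.
by rewrite -EFinD sE; split=> [[]|->].
Qed.

End GeometricMoments.

(** * Asymptotics of the largest component *)

Lemma C1_log_upper (R : realType) (q c : R) : 0 <= q < 1 -> 0 < c ->
  c < (1 - q) / (1 + q) ->
  exists alpha : R, inv_abs_log q < alpha /\
    graph_prob q c
      (fun G : {set 'I_N * 'I_N} => alpha * ln (N%:R : R) < (C1 G)%:R)
      @[N --> \oo] --> (0 : R).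
Proof.
move=> q01 c0 cc; have /andP[q0 q1] := q01.
pose k := c * ((1 + q) / (1 - q)).
have k01 : 0 < k < 1.
  rewrite mulr_gt0 ?divr_gt0 //=; [|lra|lra].
  by rewrite /k mulrA ltr_pdivrMr ?mul1r -?ltr_pdivlMr //; lra.
have [|C [delta [A [C0 d0 A0 bound]]]] := @C1_upper R q c q01 c0 k 0 k01 (lexx _).
  move=> mu mu0 _; apply: le_trans (surv_linear q01 _) _.
    by rewrite mulr_ge0 // ltW.
  by rewrite /k mulrAC.
have l0 : 0 <= inv_abs_log q.
  by rewrite /inv_abs_log; case: ifP => // _; rewrite divr_ge0.
(* The term 4/delta brings the exponential down to at most N^(-4), against the N^3 of [C1_upper];
   the other terms place alpha above [inv_abs_log q]. *)
exists (inv_abs_log q + 1 + 4 / delta).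
have d4 : 0 < 4 / delta by rewrite divr_gt0.
split; first by lra.
apply: (@cvg_exp_ln _ _ C 1 (1 + (A + 2 * c))) => // N AN.
have N1 : 1 <= N%:R :> R by lra.
have x0 : 0 <= ln (N%:R : R) by rewrite ln_ge0.
have a0 : 0 <= inv_abs_log q + 1 + 4 / delta by lra.
rewrite graph_prob_ge0 //=; last by lra.
apply: le_trans (bound N _ _ _ _) _; [lra|exact: mulr_ge0| |].
  by rewrite mul0r mulr_ge0.
rewrite -mulrA; apply: ler_wpM2l; first exact: ltW.
have -> : N%:R ^+ 3 = expR (3 * ln (N%:R : R)).
  by rewrite expRM_natl lnK // posrE; lra.
rewrite -expRD ler_expR.
have -> : delta * ((inv_abs_log q + 1 + 4 / delta) * ln N%:R) =
    (delta * (inv_abs_log q + 1)) * ln N%:R + 4 * ln (N%:R : R).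
  by field; rewrite gt_eqF.
have : 0 <= delta * (inv_abs_log q + 1) * ln (N%:R : R).
  by rewrite !mulr_ge0 //; lra.
lra.
Qed.

(** Only a fixed point beta with phi(b) < b beyond it enters, so the critical case beta = 0 is
    treated in the same way, its lower tail being empty. *)
Lemma C1_cvg_in_prob (R : realType) (q c beta : R) : 0 <= q < 1 -> 0 < c ->
  0 <= beta -> surv q (expR (- (c * beta))) = beta ->
  (forall b, beta < b -> surv q (expR (- (c * b))) < b) ->
  graph_cvg_in_prob q c
    (fun (N : nat) (G : {set 'I_N * 'I_N}) => (C1 G)%:R / N%:R) beta.
Proof.
move=> q01 c0 b0 bE above eps e0.
have be0 : 0 < beta + eps by lra.
pose k := surv q (expR (- (c * (beta + eps)))) / (beta + eps).
have k01 : 0 < k < 1.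
  have cb : 0 < c * (beta + eps) by rewrite mulr_gt0.
  rewrite divr_gt0 //=; last first.
    by apply: surv_gt0 => //; rewrite expR_ge0 -expR0 ltr_expR oppr_lt0.
  by rewrite ltr_pdivrMr // mul1r; apply: above; lra.
have [|C [delta [A [C0 d0 A0 bound]]]] :=
    @C1_upper R q c q01 c0 k (beta + eps) k01 (ltW be0).
  by move=> mu _ bmu; apply: surv_above.
have [C' [delta' [A' [C'0 d'0 A'0 bound']]]] :
    exists C' delta' A' : R, [/\ 0 < C', 0 < delta', 0 < A' &
    forall N, A' <= N%:R ->
      graph_prob q c
        (fun G : {set 'I_N * 'I_N} => (C1 G)%:R < (beta - eps) * N%:R) <=
      C' * N%:R ^+ 3 * expR (- (delta' * N%:R))].
  have [eb|eb] := ltP eps beta; first by apply: C1_lower => //; rewrite e0.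
  (* When eps >= beta the event is empty, so the constants are arbitrary. *)
  exists 1, 1, (2 * c + 1); split=> // [|N AN]; first by lra.
  apply: (@le_trans _ _ (graph_prob q c (fun G : {set 'I_N * 'I_N} => false))).
    apply: graph_prob_le => // [|G _]; first by lra.
    rewrite ltNge => /negP[]; apply: (@le_trans _ _ 0) => //.
    by rewrite mulr_le0_ge0 //; lra.
  rewrite graph_probE /bern_mean big1 => [|G _]; last by rewrite mulr0.
  by rewrite mul1r mulr_ge0 ?exprn_ge0 ?expR_ge0.
pose D := delta * (beta + eps); have D0 : 0 < D by rewrite mulr_gt0.
apply: (@cvg_exp_ln _ _ (C * (4 / D) ^+ 4 + C' * (4 / delta') ^+ 4) 1
  (1 + (A + A' + 2 * c))) => // N AN.
have N1 : 1 <= N%:R :> R by lra.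
have N0 : 0 < N%:R :> R by lra.
have cN : 2 * c <= N%:R by lra.
rewrite graph_prob_ge0 //=.
apply: (@le_trans _ _
  (graph_prob q c (fun G : {set 'I_N * 'I_N} =>
     (beta + eps) * N%:R < (C1 G)%:R) +
   graph_prob q c (fun G : {set 'I_N * 'I_N} =>
     (C1 G)%:R < (beta - eps) * N%:R))).
  rewrite !graph_probE -bern_meanD; apply: le_bern_mean => [e|G _].
    have /andP[p0 p1] := edge_prob_range c0 cN.
    by case: ifP => _; lra.
  rewrite -natrD ler_nat; case: (ltP eps) => //= h.
  case: (ltP _ (C1 G)%:R) => //= h1; case: (ltP (C1 G)%:R) => //= h2.
  move: h; rewrite ltNge ler_distl ler_pdivlMr // ler_pdivrMr //.
  by rewrite h1 h2.
rewrite [leRHS]mulrDl; apply: lerD.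
  apply: le_trans (bound N ((beta + eps) * N%:R) _ _ _) _ => //; [lra| |].
    by rewrite mulr_ge0 // ltW.
  rewrite -!(mulrA C); apply: ler_wpM2l; first exact: ltW.
  by rewrite (mulrA delta) -/D; apply: pow3_expR_le.
apply: le_trans (bound' N _) _; first by lra.
rewrite -!(mulrA C'); apply: ler_wpM2l; first exact: ltW.
exact: pow3_expR_le.
Qed.

Theorem theorem1p1 (R : realType) (q c : R) (hq0 : 0 <= q) (hq1 : q < 1)
    (hc : 0 < c)
    (d : measure_display) (T : measurableType d) (P : probability T R)
    (X : {RV P >-> R}) (hX : geometric_law q X) :
  c_cr X = (1 - q) / (1 + q) /\
  (c < c_cr X ->
     (exists alpha : R, inv_abs_log q < alpha /\
        graph_prob q c
          (fun G : {set 'I_N * 'I_N} => alpha * ln (N%:R : R) < (C1 G)%:R)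
          @[N --> \oo] --> (0 : R)) /\
     (forall alpha1 : R, alpha1 < inv_abs_log q ->
        graph_prob q c
          (fun G : {set 'I_N * 'I_N} => (C1 G)%:R < alpha1 * ln (N%:R : R))
          @[N --> \oo] --> (0 : R))) /\
  (c_cr X <= c ->
     exists beta : R, beta_maximal_solution c X beta /\
       graph_cvg_in_prob q c
         (fun (N : nat) (G : {set 'I_N * 'I_N}) => (C1 G)%:R / N%:R) beta).
Proof.
have q01 : 0 <= q < 1 by rewrite hq0.
rewrite (c_cr_geometric q01 hX); split=> //; split=> [cc|_].
  by split=> [|alpha1]; [exact: C1_log_upper|exact: C1_log_lower].
have [beta b0 [bE bmax above]] := surv_fixpoint q01 hc.
exists beta; split; last exact: C1_cvg_in_prob.
split; first by apply/(beta_solution_geometric q01 hX hc b0).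
(* A negative b' lies below beta whatever the expectation is; the others are fixed points of phi. *)
move=> b'; have [b'0|/ltW b'0 _] := leP 0 b'; last exact: le_trans b'0 b0.
by move=> /(beta_solution_geometric q01 hX hc b'0)/bmax; apply.
Qed.
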